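(* For $m=1,\dots,N$, we have $W'_m\in\mathcal{W}^K_R$.
   Context: Let $N\ge 2$ be an integer, $K$ an indeterminate, $R=\mathbb{C}[K,(K-1)^{-1}]$. For an element $A$ of a vertex algebra write $A(z)=\sum_{n\in\mathbb{Z}}A_{(n)}z^{-n-1}$; $\partial$ is the translation operator and $\mathbf{1}$ the vacuum. Let $\mathbb{V}$ be the free $\mathbb{C}[K]$-module with basis $A_1,\dots,A_{N-1},Q,Y$ and symmetric bilinear form $(A_i,A_i)=2K$, $(A_i,A_{i+1})=-K$, $(A_i,A_j)=0$ for $|i-j|\ge2$, $(Q,Q)=1$, $(Q,A_1)=-K$, $(Q,A_j)=0$ for $j\ge2$, $(Q,Y)=1$, $(Y,Y)=0$, $(Y,A_i)=0$ for all $i$. Let $\mathcal{H}^K$ be the Heisenberg vertex algebra over $\mathbb{C}[K]$ generated by $a\in\mathbb{V}$ with OPE $a(z)b(w)\sim (a,b)/(z-w)^2$. For $w\in\mathbb{V}$ let $\mathcal{H}^K_w$ be the $\mathcal{H}^K$-module of highest weight $w$, with highest weight vector $e^{\int w}$ (so $a_{(n)}e^{\int w}=\delta_{n,0}(a,w)e^{\int w}$ for $n\ge0$), and $\partial e^{\int w}=w_{(-1)}e^{\int w}$. Let $\mathcal{V}^K_{\mathbb{C}[K]}=\bigoplus_{m\in\mathbb{Z}}\mathcal{H}^K_{mY}$ be the (half-lattice) vertex algebra with vertex operators $e^{m\int Y}(z)$. For $b=Q$ or $b=A_i$, let $e^{\int b}(z)=\sum_n e^{\int b}_{(n)}z^{-n-1}=S_b\,z^{b_{(0)}}\exp\bigl(\sum_{n>0}b_{(-n)}z^n/n\bigr)\exp\bigl(-\sum_{n>0}b_{(n)}z^{-n}/n\bigr)$,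 where $S_b$ sends $e^{\int w}$ to $e^{\int(w+b)}$ and commutes with $a_{(n)}$, $n\ne0$; the screening operators are $e^{\int b}_{(0)}:\mathcal{H}^K_{mY}\to\mathcal{H}^K_{mY+b}$. Put $\mathcal{V}^K_R=\mathcal{V}^K_{\mathbb{C}[K]}\otimes_{\mathbb{C}[K]}R$. $\mathcal{W}^K_{\mathbb{C}[K]}$ is the subregular W-algebra over $\mathbb{C}[K]$ at level $K-N$, i.e. the generalized quantum Drinfeld–Sokolov reduction for $\mathfrak{sl}_N$ and $f_{sub}=e_{-\alpha_2}+\dots+e_{-\alpha_{N-1}}$. By a known theorem (Genra), it is isomorphic to, and is identified with, $\ker e^{\int Q}_{(0)}\cap\bigcap_{i=1}^{N-1}\ker e^{\int A_i}_{(0)}\subset\mathcal{V}^K_{\mathbb{C}[K]}$. Put $\mathcal{W}^K_R=\mathcal{W}^K_{\mathbb{C}[K]}\otimes_{\mathbb{C}[K]}R\subset\mathcal{V}^K_R$. For $i=1,\dots,N$ let $X_i=-\frac{K}{N}Y-\sum_{j=1}^{i-1}\frac{j}{N}A_j+\sum_{j=i}^{N-1}\frac{N-j}{N}A_j$, and $X_0=-\frac KN Y+Q+\sum_{j=1}^{N-1}\frac{N-j}{N}A_j$. Let $\sigma_i=(K-1)\partial-X_{i(-1)}$ for $i=0,\dots,N$. For operators $\xi_1,\dots,\xi_n$ put $e_m(\xi_1,\dots,\xi_n)=\sum_{i_1>i_2>\dots>i_m}\xi_{i_1}\xi_{i_2}\cdots\xi_{i_m}$. For $m=1,\dots,N$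 define $$W'_m=\sum_{k=0}^N(-1)^k\prod_{j=1}^k\frac{j(K-1)+1}{j(K-1)}\sum_{1\le i_1<\dots<i_{N-k}\le N}e_m(\underbrace{\sigma_0,\dots,\sigma_0}_{k\text{ times}},\sigma_{i_1},\dots,\sigma_{i_{N-k}})\,\mathbf{1}\in\mathcal{V}^K_R .$$ *)

(* Defs.v *)
From HB Require Import structures.
From mathcomp Require Import all_boot all_order all_algebra.
From mathcomp Require Import finmap monalg.
From mathcomp Require Import boolp reals.
From mathcomp Require Import complex fraction.

Set Implicit Arguments.
Unset Strict Implicit.
Unset Printing Implicit Defensive.

Import GRing.Theory.

Local Open Scope ring_scope.

Section GradedMap.

(* [gmap f] is the map of direct sums with components [f k]; it has the
   expected coefficients as soon as every [f k] sends 0 to 0. *)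
Definition gmap (I : choiceType) (G G' : zmodType) (f : I -> G -> G')
    (v : {malg G[I]}) : {malg G'[I]} :=
  \sum_(k <- msupp v) << f k v@_k *g k >>.

Lemma gmapE (I : choiceType) (G G' : zmodType) (f : I -> G -> G') v k :
  f k 0 = 0 -> (gmap f v)@_k = f k v@_k.
Proof.
move=> f0; rewrite /gmap raddf_sum /=; case: (msuppP v k) => [kv|kNv].
  rewrite (big_fsetD1 k) //= mcoeffUU big1_fset ?addr0 // => j.
  by rewrite in_fsetD1 mcoeffU => /andP[/negbTE-> _].
rewrite f0 big_seq big1 // => j jv; rewrite mcoeffU.
by case: eqP jv kNv => // -> ->.
Qed.

End GradedMap.

Section AlgebraFacts.

Variables (S : comUnitRingType) (A : comAlgType S).
Implicit Types (c : S) (f g h k : A).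

Lemma scale0_mul f g h : 0 *: f = (0 *: g) * h.
Proof. by rewrite !scale0r mul0r. Qed.

Lemma scaleM_mul c f g h k : f = g * h -> c *: (f * k) = (c *: (g * k)) * h.
Proof. by move=> ->; rewrite -scalerAl mulrAC. Qed.

Lemma sum_leibniz (J : Type) (r : seq J) (F G H : J -> A) f g :
  (forall j, F j = G j * f + g * H j) ->
  \sum_(j <- r) F j = (\sum_(j <- r) G j) * f + g * \sum_(j <- r) H j.
Proof.
by move=> FE; rewrite mulr_suml mulr_sumr -big_split; apply: eq_bigr.
Qed.

Lemma leibniz_span (D : {linear A -> A}) (J : Type) (e : J -> A)
    (c d : J -> S) (r s : seq J) :
  (forall i j, D (e i * e j) = D (e i) * e j + e i * D (e j)) ->
  let f := \sum_(i <- r) c i *: e i in let g := \sum_(j <- s) d j *: e j in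
  D (f * g) = D f * g + f * D g.
Proof.
move=> De f g.
have -> : f * D g = \sum_(i <- r) c i *: e i * D g by rewrite -mulr_suml.
have -> : D f = \sum_(i <- r) D (c i *: e i) by rewrite linear_sum.
rewrite mulr_suml linear_sum mulr_suml -big_split; apply: eq_bigr => i _ /=.
have -> : D g = \sum_(j <- s) D (d j *: e j) by rewrite linear_sum.
rewrite !mulr_sumr linear_sum -big_split; apply: eq_bigr => j _ /=.
by rewrite -scalerAl -scalerAr !linearZ /= De !scalerDr -!scalerAl -!scalerAr.
Qed.

End AlgebraFacts.

Section Derivation.

Variables (S : comUnitRingType) (I : choiceType).

Local Notation pol := {malg S[{cmonom I}]}.

Definition var (u : I) : pol := << ucm u >>.

(* the S-linear derivation of S[x_u : u in I] such that x_u |-> delta u *)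
Definition mon_der (delta : I -> pol) (mu : {cmonom I}) : pol :=
  \sum_(u <- finsupp mu) (mu u)%:R *: (<< divcm mu (ucm u) >> * delta u).

Definition der (delta : I -> pol) (f : pol) : pol :=
  \sum_(mu <- msupp f) f@_mu *: mon_der delta mu.

Lemma derEw delta f (d : {fset {cmonom I}}) : (msupp f `<=` d)%fset ->
  der delta f = \sum_(mu <- d) f@_mu *: mon_der delta mu.
Proof.
move=> le; rewrite [LHS](big_fset_incl _ le) //= => x _ /mcoeff_outdom ->.
by rewrite scale0r.
Qed.

Lemma der_linear delta c f g : der delta (c *: f + g) = c *: der delta f + der delta g.
Proof.
pose d := (msupp f `|` msupp g `|` msupp (c *: f + g))%fset.
have [lf lg lh] : [/\ msupp f `<=` d, msupp g `<=` d & msupp (c *: f + g) `<=` d]%fset.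
  by split; apply/fsubsetP=> x; rewrite !in_fsetU => ->; rewrite ?orbT.
rewrite (derEw _ lf) (derEw _ lg) (derEw _ lh) scaler_sumr -big_split /=.
by apply: eq_bigr => mu _; rewrite mcoeffD mcoeffZ scalerDl scalerA.
Qed.

HB.instance Definition _ delta :=
  GRing.isLinear.Build S pol pol *:%R (der delta) (der_linear delta).

Lemma derU delta mu : der delta << mu >> = mon_der delta mu.
Proof. by rewrite (derEw _ msuppU_le) big_seq_fset1 mcoeffUU scale1r. Qed.

Lemma mon_derEw delta (mu : {cmonom I}) (d : {fset I}) : (finsupp mu `<=` d)%fset ->
  mon_der delta mu =
  \sum_(u <- d) (mu u)%:R *: (<< divcm mu (ucm u) >> * delta u).
Proof.
move=> le; rewrite [LHS](big_fset_incl _ le) //= => x _ xN.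
by move: xN; rewrite -cmE_eq0 => /eqP ->; rewrite scale0r.
Qed.

Lemma der_var delta u : der delta (var u) = delta u.
Proof.
rewrite derU /mon_der mdomU big_seq_fset1 cmUU scale1r.
have -> : divcm (ucm u) (ucm u) = mone :> {cmonom I}.
  by apply/eqP/cmP=> i; rewrite divcmE subnn cm1.
by rewrite mul1r.
Qed.

Lemma malgUM (mu nu : {cmonom I}) :
  (<< mu >> : pol) * << nu >> = << mmul mu nu >>.
Proof.
by rewrite (malgMEw msuppU_le msuppU_le) !big_seq_fset1 !mcoeffUU mulr1.
Qed.

Lemma malgZU (c : S) (k : {cmonom I}) : c *: (<< k >> : pol) = << c *g k >>.
Proof. by apply/malgP => j; rewrite mcoeffZ [in LHS]mcoeffU [in RHS]mcoeffU mulrnAr mulr1. Qed.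

Lemma malg_sumE (h : pol) : h = \sum_(k <- msupp h) h@_k *: << k >>.
Proof. by rewrite {1}(monalgE h); apply: eq_bigr => k _; rewrite malgZU. Qed.

Lemma der_sumE delta (h : pol) :
  der delta h = \sum_(k <- msupp h) h@_k *: der delta << k >>.
Proof. by apply: eq_bigr => k _; rewrite derU. Qed.

Lemma mon_derM delta (mu nu : {cmonom I}) :
  mon_der delta (mmul mu nu) =
  mon_der delta mu * << nu >> + << mu >> * mon_der delta nu.
Proof.
have l1 : (finsupp mu `<=` finsupp mu `|` finsupp nu)%fset by exact: fsubsetUl.
have l2 : (finsupp nu `<=` finsupp mu `|` finsupp nu)%fset by exact: fsubsetUr.
have aux (a b : {cmonom I}) u :
    (a u)%:R *: (<< divcm (mmul a b) (ucm u) >> * delta u)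
    = ((a u)%:R *: (<< divcm a (ucm u) >> * delta u)) * << b >>.
  case: (posnP (a u)) => [->|a0]; first exact: scale0_mul.
  apply: scaleM_mul; rewrite (malgUM (divcm a (ucm u)) b); congr << _ >>.
  apply/eqP/cmP => i; rewrite divcmE !cmM divcmE cmU addnBAC //.
  by case: eqP => // <-.
rewrite (mon_derEw _ l1) (mon_derEw _ l2) {1}/mon_der mdomD.
apply: sum_leibniz => u; rewrite cmM natrD scalerDl; congr (_ + _).
  exact: aux.
by rewrite mulmC [RHS]mulrC; exact: aux.
Qed.

Lemma derM delta f g : der delta (f * g) = der delta f * g + f * der delta g.
Proof.
rewrite (malg_sumE f) (malg_sumE g).
apply: (@leibniz_span S pol (der delta) _ (fun k => << k >>)) => mu nu.
by rewrite malgUM; have := mon_derM delta mu nu; rewrite -!derU.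
Qed.

End Derivation.

Section HalfLattice.

(* [N] and the value [K] of the indeterminate in the coefficient ring [S]; in
   the application S is an algebra over the complex numbers, so all n%:R with
   n > 0 are units. *)
Variables (N : nat) (S : comUnitRingType) (K : S).

(* The basis of the weight lattice: index 0 is Q, index i (0 < i < N) is A_i,
   index N is Y. *)
Definition iQ : 'I_N.+1 := ord0.
Definition iA (i : nat) : 'I_N.+1 := inord i.
Definition iY : 'I_N.+1 := ord_max.

Definition gram (i j : 'I_N.+1) : S :=
  if i == iY then (j == iQ)%:R
  else if j == iY then (i == iQ)%:R
  else if i == j then (if i == iQ then 1 else 2 * K)
  else if (i == j.+1 :> nat) || (j == i.+1 :> nat) then - K else 0.

Definition weight := 'rV[S]_N.+1.

Definition form (u v : weight) : S :=
  \sum_i \sum_j u 0 i * gram i j * v 0 j.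

Definition base (i : 'I_N.+1) : weight := delta_mx 0 i.
Definition vQ : weight := base iQ.
Definition vA (i : nat) : weight := base (iA i).
Definition vY : weight := base iY.

(* The Fock module H_w, for any weight w, as an S-module: the monomial
   x_(i1,n1) ... x_(ir,nr) stands for
   b_i1_(-n1-1) ... b_ir_(-nr-1) e^(int w), where b_i is [base i]. *)
Definition var_idx : choiceType := ('I_N.+1 * nat)%type.
Definition Fock := {malg S[{cmonom var_idx}]}.

(* [heis w a n] is the mode a_(n) on H_w. *)
Definition heis (w a : weight) (n : int) (f : Fock) : Fock :=
  match n with
  | Posz 0 => form a w *: f
  | Posz n'.+1 =>
      der (fun u : var_idx =>
             if u.2 == n' then (n'.+1%:R * form a (base u.1))%:MP else 0) f
  | Negz n' => (\sum_i a 0 i *: var S (i, n')) * f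
  end.

(* The translation operator on H_w. *)
Definition trans (w : weight) (f : Fock) : Fock :=
  der (fun u : var_idx => u.2.+1%:R *: var S (u.1, u.2.+1)) f + heis w w (-1) f.

(* [exp_coef x k v] is the coefficient of z^k in exp(\sum_(n > 0) x_n z^n / n) v:
   a series in z with coefficients in Fock is a map nat -> Fock, and the
   exponent strictly raises the order in z. *)
Definition exp_arg (x : nat -> Fock -> Fock) (s : nat -> Fock) : nat -> Fock :=
  fun k => \sum_(1 <= n < k.+1) n%:R^-1 *: x n (s (k - n)%N).

Definition exp_coef (x : nat -> Fock -> Fock) (k : nat) (v : Fock) : Fock :=
  \sum_(j < k.+1) j`!%:R^-1 *:
     iter j (exp_arg x) (fun i => if i == 0%N then v else 0) k.

(* The conformal weight of a vector of H_w, relative to e^(int w). *)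
Definition mon_wt (mu : {cmonom var_idx}) : nat :=
  (\sum_(u <- finsupp mu) mu u * u.2.+1)%N.
Definition wt (f : Fock) : nat := (\max_(mu <- msupp f) mon_wt mu)%N.

(* The half-lattice vertex algebra (as an S-module): the direct sum over the
   integers m of the H_(mY). *)
Definition halflat := {malg Fock[int]}.

Definition wY (m : int) : weight := vY *~ m.

Definition heisV (a : weight) (n : int) : halflat -> halflat :=
  gmap (fun m => heis (wY m) a n).
Definition transV : halflat -> halflat := gmap (fun m => trans (wY m)).
Definition vac : halflat := << 1 *g 0 >>.
Definition scaleV (c : S) : halflat -> halflat := gmap (fun _ f => c *: f).

(* The integer (base i, m Y), see [pairYE]. *)
Definition pairY (i : 'I_N.+1) (m : int) : int := if i == iQ then m else 0.

(* The mode e^(int b)_(n) : H_(mY) -> H_(mY+b) for b = base i, i.e. the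
   coefficient of z^(-n-1) in
     S_b z^(b_(0)) exp(\sum_(k > 0) b_(-k) z^k / k) exp(-\sum_(l > 0) b_(l) z^(-l) / l).
   As b_(0) = pairY i m on the source, z^k z^(-l) contributes exactly when
   pairY i m + k - l = - n - 1; S_b is the identity on Fock.  The sum over l is
   finite, see [exp_coef_ann_eq0]. *)
Definition lattice_mode (i : 'I_N.+1) (n m : int) (v : Fock) : Fock :=
  \sum_(l < (wt v).+1)
    match l%:Z - pairY i m - n - 1 with
    | Posz k =>
        exp_coef (fun r => heis (wY m + base i) (base i) (- r%:Z)) k
          (exp_coef (fun r f => - heis (wY m) (base i) r%:Z f) l v)
    | Negz _ => 0
    end.

(* e^(int b)_(0) from the sum of the H_(mY) to the sum of the H_(mY+b) *)
Definition screening (i : 'I_N.+1) : halflat -> {malg Fock[int]} :=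
  gmap (lattice_mode i 0).

Definition inW (v : halflat) : Prop :=
  screening iQ v = 0 /\
  forall i : nat, (1 <= i <= N.-1)%N -> screening (iA i) v = 0.

Definition X (i : nat) : weight :=
  if i is 0 then
    - (K / N%:R) *: vY + vQ + \sum_(1 <= j < N) ((N - j)%:R / N%:R) *: vA j
  else
    - (K / N%:R) *: vY - \sum_(1 <= j < i) (j%:R / N%:R) *: vA j
      + \sum_(i <= j < N) ((N - j)%:R / N%:R) *: vA j.

Definition sigma (i : nat) (v : halflat) : halflat :=
  scaleV (K - 1) (transV v) - heisV (X i) (-1) v.

(* e_m(xi_1, ..., xi_n) v: since [enum A] is increasing, the operators are
   composed with indices decreasing from left to right. *)
Definition esym_op (m : nat) (xi : seq (halflat -> halflat)) (v : halflat) :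
    halflat :=
  \sum_(A : {set 'I_(size xi)} | #|A| == m)
    foldr (fun (i : 'I_(size xi)) => nth id xi i) v (rev (enum A)).

(* An element I of {set 'I_N} stands for {i_1 < ... < i_(N-k)}, shifted by 1. *)
Definition W' (m : nat) : halflat :=
  \sum_(k < N.+1)
    scaleV ((-1) ^+ k *
            \prod_(1 <= j < k.+1) ((j%:R * (K - 1) + 1) / (j%:R * (K - 1))))
      (\sum_(I : {set 'I_N} | #|I| == (N - k)%N)
         esym_op m (nseq k (sigma 0) ++ [seq sigma (i : 'I_N).+1 | i <- enum I])
           vac).

Lemma form_base i j : form (base i) (base j) = gram i j.
Proof.
rewrite /form (bigD1 i) //= (bigD1 j) //= !mxE !eqxx mul1r mulr1.
rewrite !big1 ?addr0 // => [k /negbTE ki|k /negbTE kj].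
  by rewrite big1 // => l _; rewrite !mxE ki andbF !mul0r.
by rewrite !mxE kj andbF mulr0.
Qed.

Lemma formDl u v w : form (u + v) w = form u w + form v w.
Proof.
rewrite /form -big_split; apply: eq_bigr => i _; rewrite -big_split.
by apply: eq_bigr => j _; rewrite !mxE !mulrDl.
Qed.

Lemma formZl c u w : form (c *: u) w = c * form u w.
Proof.
rewrite /form mulr_sumr; apply: eq_bigr => i _; rewrite mulr_sumr.
by apply: eq_bigr => j _; rewrite !mxE !mulrA.
Qed.

Lemma gramC i j : gram i j = gram j i.
Proof.
rewrite /gram orbC [j == i]eq_sym; case: (eqVneq i iY) => [->|iN].
  by case: (eqVneq j iY) => [->|].
by case: (j == iY) => //; case: (eqVneq i j) => // ->.
Qed.

Lemma formC u v : form u v = form v u.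
Proof.
rewrite /form exchange_big; apply: eq_bigr => i _; apply: eq_bigr => j _.
by rewrite gramC mulrC [u 0 _ * _]mulrC mulrA.
Qed.

Lemma pairYE i m : (0 < N)%N -> form (base i) (wY m) = (pairY i m)%:~R.
Proof.
move=> N0; rewrite formC /wY -scaler_int formZl form_base /gram eqxx /pairY.
by case: eqP; rewrite ?mulr1 ?mulr0.
Qed.

Section FormValues.

Hypothesis N2 : (1 < N)%N.

Lemma iA_val i : (i < N)%N -> iA i = i :> nat.
Proof. by move=> iN; rewrite inordK // ltnS ltnW. Qed.

Lemma iA_neqY i : (i < N)%N -> (iA i == iY) = false.
Proof. by move=> iN; rewrite -val_eqE /= iA_val // ltn_eqF. Qed.

Lemma iQ_neqY : (iQ == iY) = false.
Proof. by rewrite -val_eqE /= ltn_eqF // ltnW. Qed.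

Lemma iA_neqQ i : (0 < i < N)%N -> (iA i == iQ) = false.
Proof. by case/andP=> i0 iN; rewrite -val_eqE /= iA_val // gtn_eqF. Qed.

Lemma form_YY : form vY vY = 0.
Proof. by rewrite form_base /gram eqxx eq_sym iQ_neqY. Qed.

Lemma form_QY : form vQ vY = 1.
Proof. by rewrite form_base /gram iQ_neqY !eqxx. Qed.

Lemma form_QQ : form vQ vQ = 1.
Proof. by rewrite form_base /gram iQ_neqY eqxx. Qed.

Lemma form_YA i : (0 < i < N)%N -> form vY (vA i) = 0.
Proof. by move=> iN; rewrite form_base /gram eqxx iA_neqQ. Qed.

Lemma form_AA i : (0 < i < N)%N -> form (vA i) (vA i) = 2 * K.
Proof.
move=> iN; rewrite form_base /gram eqxx iA_neqQ // iA_neqY //.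
by case/andP: iN.
Qed.

Lemma form_AS i : (0 < i)%N -> (i.+1 < N)%N -> form (vA i) (vA i.+1) = - K.
Proof.
move=> i0 iN; have iN' := ltnW iN.
rewrite form_base /gram !iA_neqY // -!val_eqE /= !iA_val // eqxx orbT.
by rewrite ltn_eqF.
Qed.

Lemma form_A_far i j : (0 < i < N)%N -> (0 < j < N)%N -> (i.+1 < j)%N ->
  form (vA i) (vA j) = 0.
Proof.
case/andP=> _ iN /andP[_ jN] ij.
rewrite form_base /gram !iA_neqY // -!val_eqE /= !iA_val //.
rewrite (ltn_eqF (ltnW ij)) (gtn_eqF ij) (ltn_eqF (leq_trans (ltnW ij) (leqnSn j))).
by [].
Qed.

Lemma form_QA1 : form vQ (vA 1) = - K.
Proof.
by rewrite form_base /gram iQ_neqY !iA_neqY // -!val_eqE /= !iA_val.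
Qed.

Lemma form_QA i : (1 < i < N)%N -> form vQ (vA i) = 0.
Proof.
case/andP=> i1 iN; rewrite form_base /gram iQ_neqY iA_neqY // -!val_eqE /=.
by rewrite !iA_val // (gtn_eqF i1) ltn_eqF // ltnW.
Qed.

End FormValues.

Section Truncation.

Lemma mon_wtE (mu : {cmonom var_idx}) (d : {fset var_idx}) :
  (finsupp mu `<=` d)%fset -> mon_wt mu = (\sum_(u <- d) mu u * u.2.+1)%N.
Proof.
move=> le; rewrite [LHS](big_fset_incl _ le) //= => x _ xN.
by move: xN; rewrite -cmE_eq0 => /eqP ->.
Qed.

Lemma mon_wtM mu nu : mon_wt (mmul mu nu) = (mon_wt mu + mon_wt nu)%N.
Proof.
rewrite {1}/mon_wt mdomD.
rewrite (mon_wtE (fsubsetUl _ (finsupp nu))) (mon_wtE (fsubsetUr (finsupp mu) _)).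
by rewrite -big_split /=; apply: eq_bigr => u _; rewrite cmM mulnDl.
Qed.

Lemma mon_wtU u : mon_wt (ucm u) = u.2.+1.
Proof. by rewrite /mon_wt mdomU big_seq_fset1 cmUU mul1n. Qed.

Let bounded (t d : nat) (f : Fock) :=
  forall mu, f@_mu != 0 -> (mon_wt mu + t <= d)%N.

Let bounded0 t d : bounded t d 0.
Proof. by move=> mu; rewrite mcoeff0 eqxx. Qed.

Let boundedD t d f g : bounded t d f -> bounded t d g -> bounded t d (f + g).
Proof.
move=> bf bg mu; rewrite mcoeffD; have [->|/bf //] := eqVneq f@_mu 0.
by rewrite add0r => /bg.
Qed.

Let boundedZ t d c f : bounded t d f -> bounded t d (c *: f).
Proof.
move=> bf mu; rewrite mcoeffZ; have [->|/bf //] := eqVneq f@_mu 0.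
by rewrite mulr0 eqxx.
Qed.

Let boundedN t d f : bounded t d f -> bounded t d (- f).
Proof. by move=> bf mu; rewrite mcoeffN oppr_eq0 => /bf. Qed.

Let bounded_sum t d (J : eqType) (r : seq J) (F : J -> Fock) :
  (forall j, j \in r -> bounded t d (F j)) -> bounded t d (\sum_(j <- r) F j).
Proof.
move=> bF; rewrite big_seq; apply: (big_ind (bounded t d)) => //.
exact: boundedD.
Qed.

Let bounded_ann t d w a n f :
  bounded t d f -> bounded (t + n.+1) d (heis w a n.+1%:Z f).
Proof.
move=> bf; apply: bounded_sum => mu mu_f; apply: boundedZ.
apply: bounded_sum => u u_mu; apply: boundedZ.
case: (eqVneq u.2 n) => [un|_]; last by rewrite mulr0.
rewrite mulrC mul_malgC; apply: boundedZ => nu.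
rewrite mcoeffU; have [<- _|_] := eqVneq (divcm mu (ucm u)) nu; last first.
  by rewrite mulr0n eqxx.
rewrite addnCA; suff <- : mon_wt mu = (mon_wt (divcm mu (ucm u)) + n.+1)%N.
  by move: mu_f; rewrite -mcoeff_neq0 => /bf; rewrite addnC.
rewrite -un -mon_wtU -mon_wtM; congr mon_wt; apply/eqP/cmP => i.
rewrite cmM divcmE cmU subnK //; case: eqP => // <-.
by rewrite lt0n cmE_neq0.
Qed.

Lemma exp_coef_ann_eq0 (w a : weight) (l : nat) (v : Fock) : (wt v < l)%N ->
  exp_coef (fun r f => - heis w a r%:Z f) l v = 0.
Proof.
pose x r f := - heis w a r%:Z f; pose s0 i := if i == 0%N then v else 0.
move=> lt_l; suff b : bounded l (wt v) (exp_coef x l v).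
  apply/malgP => mu; rewrite mcoeff0; apply/eqP; apply: contraTT lt_l => /b.
  by rewrite -leqNgt => /(leq_trans _); apply; rewrite leq_addl.
have bs j k : bounded k (wt v) (iter j (exp_arg x) s0 k).
  elim: j k => [|j IHj] k /=; rewrite ?/s0.
    case: eqP => [-> mu|_]; last exact: bounded0.
    by rewrite mcoeff_neq0 addn0 => mu_v; exact: leq_bigmax_seq.
  apply: bounded_sum => n; rewrite mem_index_iota => /andP[n0 nk].
  apply: boundedZ; apply: boundedN; case: n n0 nk => // n _ nk.
  by rewrite -{1}(subnK (nk : (n.+1 <= k)%N)); apply: bounded_ann.
by apply: bounded_sum => j _; apply: boundedZ.
Qed.

End Truncation.

Lemma heis0 w a n : heis w a n 0 = 0.
Proof. by case: n => [[|n]|n] /=; rewrite ?scaler0 ?linear0 ?mulr0. Qed.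

Lemma trans0 w : trans w 0 = 0.
Proof. by rewrite /trans linear0 heis0 addr0. Qed.

Lemma exp_coef0 (x : nat -> Fock -> Fock) k :
  (forall n, x n 0 = 0) -> exp_coef x k 0 = 0.
Proof.
move=> x0.
have it j i : iter j (exp_arg x) (fun i => if i == 0%N then 0 else 0) i = 0.
  elim: j i => [|j IHj] i /=; first by rewrite if_same.
  by apply: big1 => n _; rewrite IHj x0 scaler0.
by apply: big1 => j _; rewrite it scaler0.
Qed.

Lemma lattice_mode0 i n m : lattice_mode i n m 0 = 0.
Proof.
apply: big1 => l _; case: (_ - _) => // k.
rewrite (exp_coef0 l) => [|r]; last by rewrite heis0 oppr0.
by rewrite exp_coef0 // => r; rewrite heis0.
Qed.

Lemma screeningE i v m : (screening i v)@_m = lattice_mode i 0 m v@_m.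
Proof. by rewrite gmapE // lattice_mode0. Qed.

Lemma heisVE a n v m : (heisV a n v)@_m = heis (wY m) a n v@_m.
Proof. by rewrite gmapE // heis0. Qed.

Lemma transVE v m : (transV v)@_m = trans (wY m) v@_m.
Proof. by rewrite gmapE // trans0. Qed.

Lemma scaleVE c v m : (scaleV c v)@_m = c *: v@_m.
Proof. by rewrite gmapE // scaler0. Qed.

End HalfLattice.

Section Localization.

Variable C : fieldType.

Local Notation frac := {fraction {poly C}}.
Local Notation tofrac := (@FracField.tofrac {poly C}).

Definition K1 : frac := tofrac ('X - 1).

Definition loc_pred : {pred frac} :=
  fun x => `[< exists (p : {poly C}) (n : nat), x = tofrac p / K1 ^+ n >].

Lemma K1_neq0 : K1 != 0.
Proof. by rewrite tofrac_eq0 -polyC1 polyXsubC_eq0. Qed.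

Lemma loc_predP x :
  reflect (exists p n, x = tofrac p / K1 ^+ n) (x \in loc_pred).
Proof. exact: asboolP. Qed.

Lemma loc_subring : subring_closed loc_pred.
Proof.
have K1n n : K1 ^+ n != 0 by rewrite expf_neq0 // K1_neq0.
have K1X n : tofrac (('X - 1) ^+ n) = K1 ^+ n by rewrite rmorphXn.
split.
- by apply/loc_predP; exists 1, 0; rewrite rmorph1 expr0 divr1.
- move=> _ _ /loc_predP[p [n ->]] /loc_predP[q [l ->]]; apply/loc_predP.
  exists (p * ('X - 1) ^+ l - q * ('X - 1) ^+ n), (n + l)%N.
  rewrite -mulNr addf_div // exprD mulNr; congr (_ / _).
  by rewrite -!K1X -!rmorphM -rmorphB.
- move=> _ _ /loc_predP[p [n ->]] /loc_predP[q [l ->]]; apply/loc_predP.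
  by exists (p * q), (n + l)%N; rewrite exprD rmorphM mulf_div.
Qed.

HB.instance Definition _ := GRing.isSubringClosed.Build frac loc_pred loc_subring.

(* The ring C[K, (K-1)^-1], as a subring of the field C(K). *)
Record loc := Loc { loc_val : frac; loc_valP : loc_val \in loc_pred }.

HB.instance Definition _ := [isSub for loc_val].
HB.instance Definition _ := [Choice of loc by <:].
HB.instance Definition _ := [SubChoice_isSubComNzRing of loc by <:].

Definition loc_unit : {pred loc} :=
  fun x => (val x != 0) && ((val x)^-1 \in loc_pred).
Definition loc_inv (x : loc) : loc := if loc_unit x then insubd x (val x)^-1 else x.

Lemma loc_mulVr : {in loc_unit, left_inverse 1 loc_inv *%R}.
Proof.
move=> x ux; have /andP[x0 xV] : (val x != 0) && ((val x)^-1 \in loc_pred) := ux.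
apply: val_inj; rewrite rmorphM /loc_inv [loc_unit x]ux /= insubdK //.
by rewrite mulVf.
Qed.

Lemma loc_unitPl (x y : loc) : y * x = 1 -> loc_unit x.
Proof.
move=> yx; have yx1 : val y * val x = 1 by exact: (congr1 val yx).
have x0 : val x != 0.
  by apply/eqP => x0; move/eqP: yx1; rewrite x0 mulr0 eq_sym oner_eq0.
apply/andP; split=> //; have -> : (val x)^-1 = val y; last exact: valP.
by rewrite -[LHS]mul1r -yx1 mulfK.
Qed.

Lemma loc_inv_out : {in [predC loc_unit], loc_inv =1 id}.
Proof. by move=> x ux; rewrite /loc_inv (negbTE (ux : ~~ loc_unit x)). Qed.

HB.instance Definition _ :=
  GRing.ComNzRing_hasMulInverse.Build loc loc_mulVr loc_unitPl loc_inv_out.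

Lemma loc_of_poly_subproof (p : {poly C}) : tofrac p \in loc_pred.
Proof. by apply/loc_predP; exists p, 0; rewrite expr0 divr1. Qed.

Definition loc_of_poly (p : {poly C}) : loc := Loc (loc_of_poly_subproof p).

Lemma loc_of_poly_zmod : zmod_morphism loc_of_poly.
Proof. by move=> p q; apply: val_inj; exact: (rmorphB tofrac). Qed.
Lemma loc_of_poly_monoid : monoid_morphism loc_of_poly.
Proof.
split=> [|p q]; apply: val_inj; first exact: (rmorph1 tofrac).
exact: (rmorphM tofrac).
Qed.

HB.instance Definition _ :=
  GRing.isZmodMorphism.Build {poly C} loc loc_of_poly loc_of_poly_zmod.
HB.instance Definition _ :=
  GRing.isMonoidMorphism.Build {poly C} loc loc_of_poly loc_of_poly_monoid.

Lemma loc_K1_unit : loc_of_poly ('X - 1) \is a GRing.unit.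
Proof.
apply/andP; split; first exact: K1_neq0.
by apply/loc_predP; exists 1, 1%N; rewrite rmorph1 div1r expr1.
Qed.

Lemma loc_nat_unit n :
  [pchar C] =i pred0 -> (0 < n)%N -> (n%:R : loc) \is a GRing.unit.
Proof.
move=> C0 n0; rewrite -(rmorph_nat loc_of_poly); apply: rmorph_unit.
rewrite -(rmorph_nat (@polyC C)); apply: rmorph_unit.
by rewrite unitfE (pcharf0P C).1 // -lt0n.
Qed.

End Localization.

Section BaseChange.

Variables (R : realType) (N : nat).

Definition CK := {poly R[i]}.
Definition CKloc := loc R[i].

(* The map from the half-lattice vertex algebra over C[K] to the one over
   C[K, (K-1)^-1], which is its base change. *)
Definition base_change : halflat N CK -> halflat N CKloc :=
  gmap (fun _ : int => gmap (fun _ => @loc_of_poly R[i])).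

(* The subregular W-algebra at level K - N, in its free field realization. *)
Definition W_CK (v : halflat N CK) : Prop := inW 'X v.

(* W over C[K, (K-1)^-1]: the span of the image of W over C[K], that is
   the image of the tensor product of W with C[K, (K-1)^-1]. *)
Definition W_loc (v : halflat N CKloc) : Prop :=
  exists (n : nat) (r : 'I_n -> CKloc) (w : 'I_n -> halflat N CK),
    (forall i, W_CK (w i)) /\ v = \sum_i scaleV (r i) (base_change (w i)).

Definition K_loc : CKloc := loc_of_poly 'X.

End BaseChange.

(* Main.v *)
From HB Require Import structures.
From mathcomp Require Import all_boot all_order all_algebra.
From mathcomp Require Import finmap monalg.
From mathcomp Require Import boolp reals.
From mathcomp Require Import complex fraction ring.
Require Import Defs.

Set Implicit Arguments.
Unset Strict Implicit.
Unset Printing Implicit Defensive.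

Import GRing.Theory.

Local Open Scope ring_scope.

(** The vector W'_m lies in the summand of charge 0, the polynomial ring in the
    modes b_(-n-1) of the basis vectors b.  On it the screening operator
    attached to b is E = sum_(l >= 0) p_l A_(l+1), where A_l and p_l are the
    coefficients of exp(- sum_n b_(n) z^-n / n) and exp(sum_n b_(-n) z^n / n).
    Write kappa = K - 1, T for the translation operator and
    sigma = kappa T - X_(-1).  The exponential series give the commutation rules
      A_l T = T A_l + (l-1) A_(l-1),
      A_l X_(-1) = X_(-1) A_l - (b, X) A_(l-1),
      T p_l + b_(-1) p_l = (l+1) p_(l+1),
    hence A_l sigma = sigma A_l + (kappa (l-1) + (b, X)) A_(l-1), and E
    intertwines sigma with its analogue on the target as soon as (b, X) = 0
    ([ann_series_trans], [ann_series_mul], [creation_coef_trans], [ann_miura],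
    [screen_miura]).

    The sums over subsets that define W'_m are computed by adding the indices
    1, ..., N one at a time, the factor sigma_n being on the left of the earlier
    ones ([miura_sum], [miura_sumE]).  So it is enough to understand E at the
    indices that are not orthogonal to b.

    For b = A_i these are i and i+1, with (A_i, X_i) = K = - (A_i, X_(i+1)) and
    X_i - X_(i+1) = A_i.  The vectors built from the indices below i are killed
    by all A_l with l > 0, and on such vectors E kills
    sigma_i + sigma_(i+1) and sigma_(i+1) sigma_i: this is the usual Miura
    argument ([screen_miura_pair], [screen_miura_sum_pair]).

    For b = Q they are 0 and 1, with (Q, X_0) = - kappa and X_1 = X_0 - Q.  Here
    A_l kills sigma_0^m 1 for l >= 2 and
    E (sigma_0^m 1) = m kappa E (Q_(-1) sigma_0^(m-1) 1) ([screen_power]).  Among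
    the terms in which the index 1 is and is not selected this produces a
    cancellation exactly when consecutive coefficients have the ratio
    c_(k+1) / c_k = - ((k+1) kappa + 1) / ((k+1) kappa), which is the one in the
    definition of W'_m ([screen_miura_sum_repeated]).

    All this holds over any base ring in which the positive integers are
    invertible.  Clearing the denominators j kappa gives coefficients in C[K]
    ([cleared_coef]), so a vector of the W-algebra over C[K]; W'_m is the image
    of this vector divided by the unit prod_(j <= N) j kappa
    ([W'_base_change]). *)

(** * Derivations of polynomial rings *)

Definition leibniz (A : pzSemiRingType) (D : A -> A) :=
  forall f g : A, D (f * g) = D f * g + f * D g.

Section DerivationCommutator.

Variables (S : comUnitRingType) (F : comAlgType S) (I : Type) (x : I -> F).

Hypothesis gen_ind : forall P : F -> Prop,
    P 1 -> (forall f g, P f -> P g -> P (f + g)) ->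
    (forall c f, P f -> P (c *: f)) -> (forall u f, P f -> P (x u * f)) ->
  forall f, P f.

(** A commutator of derivations is again a derivation, so it is determined by its
    values on generators. *)
Lemma derivation_commutator (D1 D2 D3 : {linear F -> F}) :
    leibniz D1 -> leibniz D2 -> leibniz D3 ->
    D1 1 = 0 -> D2 1 = 0 -> D3 1 = 0 ->
    (forall u, D1 (D2 (x u)) - D2 (D1 (x u)) = D3 (x u)) ->
  forall f, D1 (D2 f) - D2 (D1 f) = D3 f.
Proof.
move=> L1 L2 L3 D11 D21 D31 E f; elim/gen_ind: f => [|f g IHf IHg|c f IHf|u f IHf].
- by rewrite D11 D21 D31 !linear0 addr0.
- by rewrite !linearD /= -IHf -IHg addrACA.
- by rewrite !linearZ /= -IHf scalerBr scalerN.
- by rewrite L3 -E -IHf L1 L2 !linearD /= !L1 !L2; ring.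
Qed.

End DerivationCommutator.

Section PolynomialInduction.

Variables (S : comUnitRingType) (I : choiceType).

Local Notation pol := {malg S[{cmonom I}]}.

Lemma var_mul_monom (u : I) (mu : {cmonom I}) :
  u \in finsupp mu -> (<< mu >> : pol) = var S u * << divcm mu (ucm u) >>.
Proof.
move=> u_mu; rewrite malgUM; congr << _ >>; apply/eqP/cmP => i.
rewrite cmM divcmE cmU subnKC //; case: eqP => // <-.
by rewrite lt0n cmE_neq0.
Qed.

(** Monomials are handled one variable at a time, so that no later argument has
    to look at exponents. *)
Lemma pol_ind (P : pol -> Prop) :
    P 1 -> (forall f g, P f -> P g -> P (f + g)) ->
    (forall c f, P f -> P (c *: f)) -> (forall u f, P f -> P (var S u * f)) ->
  forall f, P f.
Proof.
move=> P1 PD PZ PM f; rewrite (malg_sumE f); apply: (big_ind P) => [|//|mu _].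
  by rewrite -(scale0r 1); apply: PZ.
apply: PZ; have [n] := ubnP (mdeg mu).
elim: n mu => [mu|n IHn mu]; first by rewrite ltn0 => /notF[].
rewrite ltnS => le_mu; have [mu0|[u u_mu]] := fset_0Vmem (finsupp mu).
  suff -> : mu = mone :> {cmonom I} by exact: P1.
  by apply/eqP/cmP => i; rewrite cm1; apply/eqP; rewrite cmE_eq0 mu0 in_fset0.
rewrite (var_mul_monom u_mu); apply: PM; apply: IHn.
have E : mu = mmul (ucm u) (divcm mu (ucm u)) :> {cmonom I}.
  apply/eqP/cmP => i; rewrite cmM divcmE cmU subnKC //; case: eqP => // <-.
  by rewrite lt0n cmE_neq0.
by apply: leq_trans le_mu; rewrite {2}E mdegM mdegU.
Qed.

Lemma der1 (delta : I -> pol) : der delta 1 = 0.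
Proof. by rewrite derU /mon_der mdom1 big_seq_fset0. Qed.

Lemma derC (delta : I -> pol) (c : S) : der delta c%:MP = 0.
Proof. by rewrite -[_%:MP]mulr1 mul_malgC linearZ /= der1 scaler0. Qed.

Lemma der_commutator (delta1 delta2 delta3 : I -> pol) :
    (forall u, der delta1 (delta2 u) - der delta2 (delta1 u) = delta3 u) ->
  forall f, der delta1 (der delta2 f) - der delta2 (der delta1 f) = der delta3 f.
Proof.
move=> E.
pose D1 : {linear pol -> pol} := GRing.Linear.clone _ _ _ _ (der delta1) _.
pose D2 : {linear pol -> pol} := GRing.Linear.clone _ _ _ _ (der delta2) _.
pose D3 : {linear pol -> pol} := GRing.Linear.clone _ _ _ _ (der delta3) _.
have H := @derivation_commutator S _ I (@var S I) pol_ind D1 D2 D3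
  (@derM _ _ _) (@derM _ _ _) (@derM _ _ _) (der1 _) (der1 _) (der1 _).
by apply: H => u; rewrite /= !der_var.
Qed.

End PolynomialInduction.

(** * Exponential series of commuting operators *)

Lemma exchange_triangle (V : nmodType) (F : nat -> nat -> V) k :
  \sum_(1 <= n < k.+1) \sum_(1 <= l < (k - n).+1) F n l =
  \sum_(1 <= l < k.+1) \sum_(1 <= n < (k - l).+1) F n l.
Proof.
have E (G : nat -> nat -> V) : \sum_(1 <= n < k.+1) \sum_(1 <= l < (k - n).+1) G n l =
    \sum_(1 <= n < k.+1) \sum_(1 <= l < k.+1 | (n + l <= k)%N) G n l.
  apply: eq_big_nat => n /andP[_ n_k].
  rewrite (big_nat_widen _ _ k.+1) ?ltnS ?leq_subr //.
  by apply: eq_bigl => l /=; rewrite ltnS leq_subRL.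
rewrite !E (exchange_big_dep_nat xpredT) //=.
by apply: eq_big_nat => l _; apply: eq_bigl => n; rewrite addnC.
Qed.

Section ExpSeries.

Variables (S : comUnitRingType) (V : lmodType S).
Hypothesis nat_unit : forall n, (0 < n)%N -> (n%:R : S) \is a GRing.unit.

Lemma scaler_nat_inj n (u v : V) : (0 < n)%N -> n%:R *: u = n%:R *: v -> u = v.
Proof.
move=> n0 E; have un := nat_unit n0.
by rewrite -[u]scale1r -[v]scale1r -(mulVr un) -!scalerA E.
Qed.

Variable x : nat -> {linear V -> V}.

(** [series_arg] multiplies a power series in z by sum_(n > 0) x_n z^n / n, and
    [exp_series] is the exponential of that operator.  On Fock modules these are
    convertible to [exp_arg] and [exp_coef], but here the module is arbitrary. *)
Definition series_arg (s : nat -> V) : nat -> V :=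
  fun k => \sum_(1 <= n < k.+1) n%:R^-1 *: x n (s (k - n)%N).

Definition exp_series (k : nat) (v : V) : V :=
  \sum_(j < k.+1) j`!%:R^-1 *:
     iter j series_arg (fun i => if i == 0%N then v else 0) k.

Local Notation init v := (fun i : nat => if i == 0%N then v else 0).

(** Each application of [series_arg] raises the order in z, so that truncating the
    exponential at the order k loses nothing. *)
Lemma iter_series_arg_low v j k : (k < j)%N -> iter j series_arg (init v) k = 0.
Proof.
elim: j k => // j IHj k k_j; rewrite /= /series_arg big_nat big1 // => n.
case/andP=> n0 n_k; rewrite IHj ?linear0 ?scaler0 //.
by rewrite -subSn // leq_subLR (leq_trans k_j) // -add1n leq_add2r.
Qed.

Hypothesis x_comm : forall n l v, x n (x l v) = x l (x n v).

(** The Euler operator z d/dz turns X = sum_n x_n z^n / n into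
    X' = sum_n x_n z^n; as X and X' commute, it maps X^(j+1) v to
    (j+1) X' X^j v. *)
Lemma iter_series_arg_euler v j k :
  k%:R *: iter j.+1 series_arg (init v) k =
  j.+1%:R *: \sum_(1 <= n < k.+1) x n (iter j series_arg (init v) (k - n)%N).
Proof.
have step s i : i%:R *: series_arg s i = \sum_(1 <= n < i.+1) x n (s (i - n)%N) +
    \sum_(1 <= n < i.+1) n%:R^-1 *: x n ((i - n)%:R *: s (i - n)%N).
  rewrite scaler_sumr -big_split; apply: eq_big_nat => n /andP[n0 nk] /=.
  rewrite ltnS in nk; rewrite [x n (_ *: _)]linearZ /= !scalerA.
  rewrite -[X in _ = X + _]scale1r -scalerDl.
  congr (_ *: _); rewrite -{1}(subnKC nk) natrD mulrDl divrr ?nat_unit //.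
  by rewrite [_^-1 * _]mulrC.
elim: j k => [|j IHj] k.
  rewrite scale1r iterS step [X in _ + X]big1 ?addr0 // => n _.
  case: (k - n)%N => [|i]; first by rewrite scale0r linear0 scaler0.
  by rewrite scaler0 linear0 scaler0.
rewrite iterS step -[in RHS](addn1 j.+1) natrD scalerDl scale1r addrC; congr (_ + _).
transitivity (j.+1%:R *: \sum_(1 <= n < k.+1) \sum_(1 <= l < (k - n).+1)
    x l (n%:R^-1 *: x n (iter j series_arg (init v) (k - n - l)%N))).
  rewrite scaler_sumr; apply: eq_big_nat => n _.
  rewrite IHj linearZ /= scalerA mulrC -scalerA; congr (_ *: _).
  rewrite linear_sum scaler_sumr; apply: eq_big_nat => l _.
  by rewrite linearZ /= x_comm.
congr (_ *: _); rewrite exchange_triangle; apply: eq_big_nat => l _.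
rewrite -linear_sum; congr (x l _); rewrite iterS.
by apply: eq_big_nat => n _; rewrite subnAC.
Qed.

(** The differential equation z d/dz exp(X) = X' exp(X).  Since the integers are
    invertible this recursion determines the series, and every later property of
    it is proved by induction along it. *)
Lemma exp_series_rec k v :
  k%:R *: exp_series k v = \sum_(1 <= n < k.+1) x n (exp_series (k - n) v).
Proof.
have low i l : (i <= l)%N -> exp_series i v =
    \sum_(j < l.+1) j`!%:R^-1 *: iter j series_arg (init v) i.
  move=> il; rewrite /exp_series (big_ord_widen_cond l.+1 xpredT (fun j => j`!%:R^-1 *:
     iter j series_arg (init v) i)) ?ltnS //.
  rewrite [RHS](bigID (fun j : 'I__ => (j < i.+1)%N)) /= [X in _ = _ + X]big1 ?addr0 //.
  by move=> j; rewrite -ltnNge ltnS => /iter_series_arg_low ->; rewrite scaler0.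
case: k => [|k]; first by rewrite scale0r big_nil.
rewrite (low k.+1 k.+1) // big_ord_recl scalerDr !scaler0 add0r scaler_sumr.
transitivity (\sum_(j < k.+1) j`!%:R^-1 *: \sum_(1 <= n < k.+2)
     x n (iter j series_arg (init v) (k.+1 - n)%N)).
  apply: eq_bigr => j _; rewrite lift0 scalerA mulrC -scalerA iter_series_arg_euler.
  rewrite scalerA; congr (_ *: _); rewrite factS natrM invrM ?nat_unit ?fact_gt0 //.
  by rewrite -mulrA mulVr ?mulr1 ?nat_unit.
under eq_bigr do rewrite scaler_sumr.
rewrite exchange_big /=; apply: eq_big_nat => n /andP[n0 nk].
rewrite (low _ k); last by rewrite leq_subLR -(add1n k) leq_add2r.
by rewrite linear_sum; apply: eq_bigr => j _; rewrite linearZ.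
Qed.

Lemma exp_series0 v : exp_series 0 v = v.
Proof. by rewrite /exp_series big_ord1 /= fact0 invr1 scale1r. Qed.

End ExpSeries.

(** * Commutation rules of the two halves of a vertex operator *)

Section AnnihilationSeries.

Variables (S : comUnitRingType) (F : comAlgType S).
Hypothesis nat_unit : forall n, (0 < n)%N -> (n%:R : S) \is a GRing.unit.
Variable x : nat -> {linear F -> F}.
Hypothesis x_leibniz : forall n, leibniz (x n).
Hypothesis x_comm : forall n l f, x n (x l f) = x l (x n f).

Local Notation A := (exp_series x).
Let A_rec := exp_series_rec nat_unit x_comm.

Lemma ann_series_linear l c f g : A l (c *: f + g) = c *: A l f + A l g.
Proof.
have [n] := ubnP l; elim: n l => [|n IHn] l; first by rewrite ltn0.
rewrite ltnS => ln; have [->|l0] := posnP l; first by rewrite !exp_series0.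
apply: (scaler_nat_inj nat_unit l0); rewrite scalerDr scalerA mulrC -scalerA !A_rec.
rewrite scaler_sumr -big_split; apply: eq_big_nat => i /andP[i0 _] /=.
rewrite IHn ?linearD ?linearZ // (leq_trans _ ln) // ltn_subrL i0.
exact: l0.
Qed.

HB.instance Definition _ l :=
  GRing.isLinear.Build S F F *:%R (A l) (ann_series_linear l).

Lemma ann_series_const l c : (0 < l)%N -> (forall n, x n c = 0) -> A l c = 0.
Proof.
have [n] := ubnP l; elim: n l => [|n IHn] l; first by rewrite ltn0.
rewrite ltnS => ln l0 xc; apply: (scaler_nat_inj nat_unit l0).
rewrite A_rec scaler0 big_nat big1 // => i /andP[i0 il].
have [->|li0] := posnP (l - i)%N; first by rewrite exp_series0 xc.
by rewrite IHn ?linear0 // (leq_trans _ ln) // ltn_subrL i0 l0.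
Qed.

(** The operator exp(X) of a derivation X is an algebra morphism; when x_1 a is a
    constant and the other x_n kill a, it maps a to a - c z. *)
Lemma ann_series_mul (a : F) (c : S) (f : F) :
    (forall n, x n a = if n == 1%N then - c *: 1 else 0) ->
  forall l, A l.+1 (a * f) = a * A l.+1 f - c *: A l f.
Proof.
move=> xa; pose A' l := if l is l'.+1 then A l' f else 0.
suff H l : A l (a * f) = a * A l f - c *: A' l by move=> l; rewrite H.
have [n] := ubnP l; elim: n l => [|n IHn] l; first by rewrite ltn0.
rewrite ltnS => ln; have [->|l0] := posnP l.
  by rewrite !exp_series0 scaler0 subr0.
apply: (scaler_nat_inj nat_unit l0); rewrite A_rec.
transitivity (\sum_(1 <= i < l.+1) (a * x i (A (l - i)%N f)
   + (if i == 1%N then - c *: A (l - 1)%N f else 0) - c *: x i (A' (l - i)%N))).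
  apply: eq_big_nat => i /andP[i0 il]; rewrite IHn; last first.
    by rewrite (leq_trans _ ln) // ltn_subrL i0 l0.
  rewrite linearB linearZ /= x_leibniz xa; congr (_ - _); rewrite addrC; congr (_ + _).
  by case: eqP => [->|_]; rewrite ?mul0r // -scalerAl mul1r.
rewrite sumrB big_split /= -mulr_sumr -A_rec.
have -> : \sum_(1 <= i < l.+1) (if i == 1%N then - c *: A (l - 1)%N f else 0)
    = - c *: A' l.
  rewrite big_ltn // eqxx big_nat big1 ?addr0 => [|i /andP[]]; last first.
    by case: i => [|[]].
  by case: l l0 {ln} => // l _; rewrite subn1.
rewrite -scaler_sumr.
have -> : \sum_(1 <= i < l.+1) x i (A' (l - i)%N) = l.-1%:R *: A' l.
  case: l l0 {ln} => // l _ /=.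
  rewrite A_rec big_nat_recr //= subnn linear0 addr0.
  by apply: eq_big_nat => i /andP[_ il]; rewrite subSn.
have E : l%:R = 1 + l.-1%:R :> S by rewrite -[LHS](congr1 _ (prednK l0)) mulrS.
rewrite scalerBr -scalerAr scaleNr -addrA -opprD [in X in _ = _ - X]E scalerDl scale1r.
by rewrite !scalerA [c * _]mulrC.
Qed.

Variable T : {linear F -> F}.
(* x_n plays the role of - b_(n); b_(0) vanishes on the charge 0 part *)
Hypothesis x0 : forall f, x 0 f = 0.
Hypothesis x_T : forall n f, x n.+1 (T f) = T (x n.+1 f) + n.+1%:R *: x n f.

(** Translation covariance [A(z), T] = - d/dz A(z) for the series
    A(z) = sum_l A_l z^-l. *)
Lemma ann_series_trans l f : A l.+1 (T f) = T (A l.+1 f) + l%:R *: A l f.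
Proof.
suff H m : A m (T f) = T (A m f) + m.-1%:R *: A m.-1 f by rewrite H.
have [n] := ubnP m; elim: n m => [|n IHn] m; first by rewrite ltn0.
rewrite ltnS => mn; have [->|m0] := posnP m.
  by rewrite !exp_series0 scale0r addr0.
apply: (scaler_nat_inj nat_unit m0); rewrite A_rec.
transitivity (\sum_(1 <= i < m.+1) (T (x i (A (m - i)%N f))
   + (i%:R *: x i.-1 (A (m - i)%N f) + (m - i).-1%:R *: x i (A (m - i).-1 f)))).
  apply: eq_big_nat => i /andP[i0 il]; rewrite IHn; last first.
    by rewrite (leq_trans _ mn) // ltn_subrL i0 m0.
  by rewrite linearD linearZ /= addrA; case: i i0 {il} => // i _; rewrite x_T.
rewrite big_split /= -linear_sum -A_rec scalerDr linearZ; congr (_ + _).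
case: m m0 {mn} => // m _; rewrite big_split /=.
rewrite big_ltn // x0 scaler0 add0r big_add1 /= [X in _ + X]big_nat_recr //=.
rewrite subnn scale0r addr0 -big_split /= A_rec scaler_sumr.
apply: eq_big_nat => i /andP[i0 im]; rewrite subSS subSn ?(ltnW im) //= -scalerDl.
by rewrite -natrD addSn subnKC // -ltnS.
Qed.

End AnnihilationSeries.

Section CreationSeries.

Variables (S : comUnitRingType) (F : comAlgType S).
Hypothesis nat_unit : forall n, (0 < n)%N -> (n%:R : S) \is a GRing.unit.
Variables (y : nat -> {linear F -> F}) (b : nat -> F).
Hypothesis yE : forall n f, y n f = b n * f.

Lemma creation_comm n l f : y n (y l f) = y l (y n f).
Proof. by rewrite !yE mulrCA. Qed.

Definition creation_coef (l : nat) : F := exp_series y l 1.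
Local Notation p := creation_coef.

Lemma creation_coef0 : p 0 = 1.
Proof. exact: exp_series0. Qed.

Let P_rec := exp_series_rec nat_unit creation_comm.

Lemma exp_series_creation l f : exp_series y l f = p l * f.
Proof.
have [n] := ubnP l; elim: n l => [|n IHn] l; first by rewrite ltn0.
rewrite ltnS => ln; have [->|l0] := posnP l.
  by rewrite creation_coef0 exp_series0 mul1r.
apply: (scaler_nat_inj nat_unit l0); rewrite scalerAl /p !P_rec mulr_suml.
apply: eq_big_nat => i /andP[i0 _] /=.
by rewrite IHn ?yE ?mulrA // (leq_trans _ ln) // ltn_subrL i0 l0.
Qed.

Lemma creation_coef_rec l : l%:R *: p l = \sum_(1 <= n < l.+1) b n * p (l - n)%N.
Proof. by rewrite /p P_rec; apply: eq_bigr => n _; rewrite yE. Qed.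

Lemma creation_coef1 : p 1%N = b 1%N.
Proof.
rewrite -[p 1%N]scale1r (creation_coef_rec 1) big_nat1 subnn.
by rewrite creation_coef0 mulr1.
Qed.

Variable T : {linear F -> F}.
Hypothesis T_leibniz : leibniz T.
Hypothesis T1 : T 1 = 0.
Hypothesis T_b : forall n, (0 < n)%N -> T (b n) = n%:R *: b n.+1.

(** Translation covariance of p(z) = exp(sum_n b_n z^n / n): the operator
    T + b_1 acts on p(z) as d/dz. *)
Lemma creation_coef_trans l : T (p l) + b 1%N * p l = l.+1%:R *: p l.+1.
Proof.
have [n] := ubnP l; elim: n l => [|n IHn] l; first by rewrite ltn0.
rewrite ltnS => ln; have [->|l0] := posnP l.
  by rewrite creation_coef0 T1 add0r mulr1 scale1r creation_coef1.
apply: (scaler_nat_inj nat_unit l0).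
rewrite scalerDr -linearZ creation_coef_rec linear_sum /=.
transitivity (\sum_(1 <= i < l.+1) (i%:R *: (b i.+1 * p (l - i)%N)
  + ((l - i).+1%:R *: (b i * p (l - i).+1) - b 1%N * (b i * p (l - i)%N)))
  + l%:R *: (b 1%N * p l)).
  congr (_ + _); apply: eq_big_nat => i /andP[i0 il].
  have lil : (l - i < n)%N by rewrite (leq_trans _ ln) // ltn_subrL i0 l0.
  rewrite T_leibniz T_b // -scalerAl; congr (_ + _).
  have -> : T (p (l - i)%N) = (l - i).+1%:R *: p (l - i).+1 - b 1%N * p (l - i)%N.
    by rewrite -IHn ?addrK.
  by rewrite mulrBr -scalerAr [b i * (b 1%N * _)]mulrCA.
rewrite big_split sumrB /= -mulr_sumr -creation_coef_rec -scalerAr.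
rewrite addrA addrNK creation_coef_rec scaler_sumr.
have -> : \sum_(1 <= i < l.+1) i%:R *: (b i.+1 * p (l - i)%N) =
    \sum_(1 <= i < l.+2) i.-1%:R *: (b i * p (l.+1 - i)%N).
  by rewrite [RHS]big_ltn // scale0r add0r [RHS]big_add1; apply: eq_bigr.
have -> : \sum_(1 <= i < l.+1) (l - i).+1%:R *: (b i * p (l - i).+1) =
    \sum_(1 <= i < l.+2) (l.+1 - i)%:R *: (b i * p (l.+1 - i)%N).
  rewrite [RHS]big_nat_recr //= subnn scale0r addr0.
  by apply: eq_big_nat => i /andP[_ il]; rewrite subSn.
rewrite -big_split; apply: eq_big_nat => i /andP[i0 il] /=.
rewrite -scalerDl -natrD; congr (_%:R *: _).
by case: i i0 il => // i _; rewrite !ltnS => il; rewrite subSS subnKC.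
Qed.

End CreationSeries.

(** * Sums over subsets *)

Section SubsetSums.

Definition index_seq n (A : {set 'I_n}) : seq nat := [seq nat_of_ord i | i <- enum A].

Lemma mem_index_seq n (A : {set 'I_n}) (i : 'I_n) :
  ((i : nat) \in index_seq A) = (i \in A).
Proof. by rewrite mem_map ?mem_enum //; exact: val_inj. Qed.

Lemma index_seq_lt n (A : {set 'I_n}) j : j \in index_seq A -> (j < n)%N.
Proof. by case/mapP=> i _ ->; exact: ltn_ord. Qed.

Lemma index_seq_sorted n (A : {set 'I_n}) : sorted ltn (index_seq A).
Proof.
apply: (subseq_sorted ltn_trans _ (iota_ltn_sorted 0 n)).
rewrite -val_enum_ord; apply: map_subseq.
by rewrite {1}/enum_mem -enumT; exact: filter_subseq.
Qed.

Lemma index_seq_eq n (A : {set 'I_n}) s :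
    sorted ltn s -> (forall j, j \in s -> (j < n)%N) ->
    (forall i : 'I_n, ((i : nat) \in s) = (i \in A)) -> index_seq A = s.
Proof.
move=> s_sorted s_lt sA; apply: (irr_sorted_eq ltn_trans ltnn) => // [|j].
  exact: index_seq_sorted.
have [jn|jn] := ltnP j n; first by rewrite (mem_index_seq A (Ordinal jn)) -sA.
by apply/idP/idP => [/index_seq_lt|/s_lt]; rewrite ltnNge jn.
Qed.

(** A subset of {0, ..., n} either avoids n, or is obtained from a subset of
    {0, ..., n-1} by adding n, which then comes last in increasing order.  This
    one splitting serves both for the positions in an elementary symmetric
    function and for the index sets I of W'_m. *)
Lemma sum_index_seqS (V : nmodType) n (Phi : seq nat -> V) :
  \sum_(A : {set 'I_n.+1}) Phi (index_seq A) =
  \sum_(A : {set 'I_n}) Phi (index_seq A) +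
  \sum_(A : {set 'I_n}) Phi (rcons (index_seq A) n).
Proof.
pose w (i : 'I_n) : 'I_n.+1 := widen_ord (leqnSn n) i.
have w_inj : injective w by move=> i j /(congr1 val) /= /val_inj.
have w_max i : (w i == ord_max) = false by rewrite -val_eqE /= ltn_eqF.
have ordP (i : 'I_n.+1) : i = ord_max \/ exists j, i = w j.
  have [lt_i|ge_i] := ltnP i n; last first.
    by left; apply/val_inj/anti_leq; rewrite ge_i -ltnS ltn_ord.
  by right; exists (Ordinal lt_i); apply: val_inj.
pose h' (B : {set 'I_n.+1}) : {set 'I_n} := [set i | w i \in B].
have max_im A : (ord_max \in w @: A) = false.
  by apply/imsetP=> -[i _ /eqP]; rewrite eq_sym w_max.
rewrite (bigID (fun B : {set 'I_n.+1} => ord_max \notin B)) /=; congr (_ + _).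
  rewrite (reindex_onto (fun A : {set 'I_n} => w @: A) h') /=; last first.
    move=> B maxB; apply/setP=> i; have [->|[j ->]] := ordP i.
      by rewrite max_im (negbTE maxB).
    by rewrite mem_imset // inE.
  apply: eq_big => A.
    by rewrite max_im /=; apply/eqP/setP => i; rewrite inE mem_imset.
  move=> _; congr Phi; apply: index_seq_eq; first exact: index_seq_sorted.
    by move=> j /index_seq_lt /ltnW.
  move=> i; have [->|[j ->]] := ordP i; last first.
    by rewrite [LHS](mem_index_seq A j) mem_imset.
  by rewrite max_im; apply/negP => /index_seq_lt; rewrite ltnn.
rewrite (reindex_onto (fun A : {set 'I_n} => ord_max |: w @: A) h') /=; last first.
  move=> B; rewrite negbK => maxB; apply/setP=> i; have [->|[j ->]] := ordP i.
    by rewrite setU11 maxB.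
  by rewrite in_setU1 w_max mem_imset // inE.
apply: eq_big => A.
  by rewrite setU11 /=; apply/eqP/setP => i; rewrite inE in_setU1 w_max mem_imset.
move=> _; congr Phi; apply: index_seq_eq.
- have := index_seq_sorted A; have := @index_seq_lt _ A.
  case: (index_seq A) => //= x s lt_s; rewrite rcons_path => ->.
  by apply: lt_s; exact: mem_last.
- by move=> j; rewrite mem_rcons inE => /predU1P[->|/index_seq_lt /ltnW].
- move=> i; rewrite mem_rcons inE; have [->|[j ->]] := ordP i.
    by rewrite setU11 eqxx.
  rewrite in_setU1 w_max mem_imset // [_ == _](ltn_eqF (ltn_ord j)).
  by rewrite [LHS](mem_index_seq A j).
Qed.

End SubsetSums.

Section ElementarySymmetric.

Variable V : zmodType.

(** A bare predicate, because the operators come in lists of functions. *)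
Definition additive_op (x : V -> V) := forall u v, x (u - v) = x u - x v.

Lemma additive_op0 x : additive_op x -> x 0 = 0.
Proof. by move=> xB; rewrite -(subrr 0) xB !subrr. Qed.

Lemma additive_op_sum x (I : Type) (r : seq I) (P : pred I) (G : I -> V) :
  additive_op x -> x (\sum_(i <- r | P i) G i) = \sum_(i <- r | P i) x (G i).
Proof.
move=> xB; apply: (big_morph x) => [u v|]; last exact: additive_op0.
by rewrite -{1}[v]opprK xB -[- v]sub0r xB additive_op0 // sub0r opprK.
Qed.

Definition subset_comp n (m : nat) (f : nat -> V -> V) (v : V) : V :=
  \sum_(A : {set 'I_n} | #|A| == m) foldr (fun i : 'I_n => f i) v (rev (enum A)).

Lemma subset_compE n m f v : subset_comp n m f v =
  \sum_(A : {set 'I_n})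
    if size (index_seq A) == m then foldr f v (rev (index_seq A)) else 0.
Proof.
rewrite /subset_comp big_mkcond; apply: eq_bigr => A _.
by rewrite size_map -cardE -map_rev foldr_map.
Qed.

Lemma subset_comp0 n f v : subset_comp n 0 f v = v.
Proof.
rewrite /subset_comp (big_pred1 set0) => [|A]; last exact: cards_eq0.
by rewrite enum_set0.
Qed.

Lemma eq_subset_comp n m f g v :
  (forall i, (i < n)%N -> f i = g i) -> subset_comp n m f v = subset_comp n m g v.
Proof.
move=> fg; apply: eq_bigr => A _; elim: (rev _) => //= i s ->.
by rewrite fg ?ltn_ord.
Qed.

Lemma subset_compS n m f v : additive_op (f n) ->
  subset_comp n.+1 m.+1 f v = subset_comp n m.+1 f v + f n (subset_comp n m f v).
Proof.
move=> fB; rewrite !subset_compE.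
rewrite (sum_index_seqS n (fun s => if size s == m.+1 then foldr f v (rev s) else 0)).
congr (_ + _).
rewrite additive_op_sum //; apply: eq_bigr => A _.
by rewrite size_rcons eqSS rev_rcons; case: ifP; rewrite ?additive_op0.
Qed.

(** For the half-lattice module this is convertible to [esym_op]. *)
Definition elem_sym (m : nat) (xi : seq (V -> V)) (v : V) : V :=
  subset_comp (size xi) m (nth id xi) v.

Lemma elem_sym0 xi v : elem_sym 0 xi v = v.
Proof. exact: subset_comp0. Qed.

Lemma elem_sym_nil m v : elem_sym m.+1 [::] v = 0.
Proof.
rewrite /elem_sym /subset_comp big_pred0 // => A.
by apply/negbTE; rewrite neq_ltn ltnS (leq_trans (max_card _)) // card_ord.
Qed.

(** The last operator has the largest index, hence is applied last. *)
Lemma elem_sym_rcons m xi x v : additive_op x ->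
  elem_sym m.+1 (rcons xi x) v = elem_sym m.+1 xi v + x (elem_sym m xi v).
Proof.
move=> xB; rewrite /elem_sym size_rcons subset_compS; last first.
  by rewrite nth_rcons ltnn eqxx.
rewrite nth_rcons ltnn eqxx; congr (_ + x _); apply: eq_subset_comp => i lt_i.
  by rewrite nth_rcons lt_i.
by rewrite nth_rcons lt_i.
Qed.

Lemma elem_sym_nseq m k x v : additive_op x ->
  elem_sym m (nseq k x) v = iter m x v *+ 'C(k, m).
Proof.
move=> xB; elim: k m => [|k IHk] [|m]; rewrite ?elem_sym0 ?bin0 ?mulr1n //.
  by rewrite elem_sym_nil bin0n mulr0n.
have -> : nseq k.+1 x = rcons (nseq k x) x by elim: k {IHk} => //= k ->.
rewrite elem_sym_rcons // !IHk binS mulrnDr; congr (_ + _).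
have := additive_op_sum (index_iota 0 'C(k, m)) xpredT (fun _ => iter m x v) xB.
by rewrite !sumr_const_nat subn0.
Qed.

End ElementarySymmetric.

Section MiuraSum.

Variables (S : comUnitRingType) (V : lmodType S).
Variables (c : nat -> S) (s : nat -> V -> V).

(** [miura_sum v n r m] is the coefficient of u^r t^m in
    (1 + u (1 + t s_n)) ... (1 + u (1 + t s_1)) (sum_k c_k u^k (1 + t s_0)^k) v:
    the exponent of u counts the selected operators, with multiplicity, and that
    of t is the degree of the elementary symmetric function.  Adding one index
    at a time is a two-variable recursion without any subsets. *)
Definition miura_init (v : V) (r m : nat) : V := c r *: (iter m (s 0) v *+ 'C(r, m)).

Definition miura_step (x : V -> V) (U : nat -> nat -> V) (r m : nat) : V :=
  U r m + (if r is r'.+1 then U r' m + (if m is m'.+1 then x (U r' m') else 0) else 0).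

Fixpoint miura_sum (v : V) (n : nat) : nat -> nat -> V :=
  if n is n'.+1 then miura_step (s n) (miura_sum v n') else miura_init v.

Hypothesis s_lin : forall i a u v, s i (a *: u + v) = a *: s i u + s i v.

Lemma s_additive i : additive_op (s i).
Proof. by move=> u v; rewrite addrC -scaleN1r s_lin scaleN1r addrC. Qed.

Let block (v : V) (k n q m : nat) : V :=
  \sum_(I : {set 'I_n} | #|I| == q)
    elem_sym m (nseq k (s 0) ++ [seq s (i : 'I_n).+1 | i <- enum I]) v.

Let Phi v k q m (l : seq nat) : V :=
  if size l == q then elem_sym m (nseq k (s 0) ++ [seq s j.+1 | j <- l]) v else 0.

Let blockE v k n q m :
  block v k n q m = \sum_(I : {set 'I_n}) Phi v k q m (index_seq I).
Proof.
rewrite /block big_mkcond; apply: eq_bigr => A _.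
by rewrite /Phi size_map -cardE -map_comp.
Qed.

Let block0 v k q m :
  block v k 0 q m = if q == 0%N then iter m (s 0) v *+ 'C(k, m) else 0.
Proof.
rewrite blockE (big_pred1 set0) => [|A]; last first.
  by symmetry; apply/eqP/setP => -[].
rewrite /index_seq enum_set0 /Phi /= cats0 eq_sym; case: ifP => // _.
by rewrite elem_sym_nseq //; exact: s_additive.
Qed.

Let blockS v k n q m : block v k n.+1 q m = block v k n q m +
  (if q is q'.+1 then block v k n q' m +
     (if m is m'.+1 then s n.+1 (block v k n q' m') else 0) else 0).
Proof.
rewrite !blockE sum_index_seqS; congr (_ + _); case: q => [|q].
  by rewrite big1 // => A _; rewrite /Phi size_rcons.
case: m => [|m]; rewrite !blockE.
  rewrite addr0; apply: eq_bigr => A _.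
  by rewrite /Phi size_rcons eqSS !elem_sym0.
rewrite additive_op_sum; last exact: s_additive.
rewrite -big_split; apply: eq_bigr => A _ /=.
rewrite /Phi size_rcons eqSS map_rcons -rcons_cat.
case: ifP => _; last by rewrite additive_op0 ?addr0 //; exact: s_additive.
by rewrite elem_sym_rcons //; exact: s_additive.
Qed.

Lemma miura_sumE v n r m : miura_sum v n r m = \sum_(k < r.+1) c k *:
  \sum_(I : {set 'I_n} | #|I| == (r - k)%N)
    elem_sym m (nseq k (s 0) ++ [seq s (i : 'I_n).+1 | i <- enum I]) v.
Proof.
transitivity (\sum_(k < r.+1) c k *: block v k n (r - k) m); last by [].
elim: n r m => [|n IHn] r m.
  rewrite big_ord_recr /= subnn block0 eqxx big1 ?add0r // => k _.
  by rewrite block0 subn_eq0 leqNgt ltn_ord scaler0.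
rewrite /= /miura_step !IHn; under [RHS]eq_bigr do rewrite blockS scalerDr.
rewrite [RHS]big_split; congr (_ + _); case: r => [|r].
  by rewrite big_ord1 scaler0.
rewrite big_ord_recr /= subnn scaler0 addr0.
transitivity (\sum_(k < r.+1) (c k *: block v k n (r - k) m +
   (if m is m'.+1 then s n.+1 (c k *: block v k n (r - k) m') else 0))).
  rewrite big_split !IHn; congr (_ + _); case: m => [|m]; first by rewrite big1.
  by rewrite IHn additive_op_sum //; exact: s_additive.
apply: eq_bigr => k _; rewrite subSn ?leq_ord // scalerDr; congr (_ + _).
case: m => [|m]; first by rewrite scaler0.
rewrite -[c k *: block _ _ _ _ _]addr0 s_lin additive_op0 ?addr0 //.
exact: s_additive.
Qed.

End MiuraSum.

(** * Screening operators and Miura operators *)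

Section ScreeningCalculus.

Variables (S : comUnitRingType) (F : comAlgType S) (kappa : S).
Variables (A : nat -> {linear F -> F}) (p : nat -> F) (T : {linear F -> F}).
Hypothesis A0 : forall f, A 0 f = f.
Hypothesis A_one : forall l, A l.+1 1 = 0.
Hypothesis A_T : forall l f, A l.+1 (T f) = T (A l.+1 f) + l%:R *: A l f.
Hypothesis p0 : p 0 = 1.
Hypothesis T_leibniz : leibniz T.
Hypothesis p_T : forall l, T (p l) + p 1%N * p l = l.+1%:R *: p l.+1.

Variable E : F -> F.
Hypothesis E_def : forall f, exists2 L, forall l, (L <= l)%N -> A l f = 0 &
  E f = \sum_(l < L) p l * A l.+1 f.

(* scalars are viewed in the algebra, where the ring tactic applies *)
Let scaleE c (f : F) : c *: f = GRing.in_alg F c * f.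
Proof. by rewrite [RHS]mulr_algl. Qed.

Lemma screen_eventually f : exists L0, forall L, (L0 <= L)%N ->
  A L f = 0 /\ E f = \sum_(l < L) p l * A l.+1 f.
Proof.
have [L0 A_L0 Ef] := E_def f; exists L0 => L le_L; split; first exact: A_L0.
rewrite Ef (big_ord_widen_cond L xpredT (fun l => p l * A l.+1 f) le_L).
rewrite [RHS](bigID (fun l : 'I_L => (l < L0)%N)) /= [X in _ = _ + X]big1 ?addr0 //.
by move=> l; rewrite -leqNgt => le_l; rewrite A_L0 ?mulr0 // (leq_trans le_l).
Qed.

Lemma screen_linear c f g : E (c *: f + g) = c *: E f + E g.
Proof.
have [L1 E1] := screen_eventually f; have [L2 E2] := screen_eventually g.
have [L3 E3] := screen_eventually (c *: f + g).
pose L := (L1 + L2 + L3)%N.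
have [_ ->] := E1 L (leq_trans (leq_addr _ _) (leq_addr _ _)).
have [_ ->] := E2 L (leq_trans (leq_addl _ _) (leq_addr _ _)).
have [_ ->] := E3 L (leq_addl _ _).
rewrite scaler_sumr -big_split; apply: eq_bigr => l _ /=.
by rewrite linearD linearZ /= mulrDr scalerAr.
Qed.

HB.instance Definition _ := GRing.isLinear.Build S F F *:%R E screen_linear.

(** The sum defining E may be cut anywhere beyond the last nonzero A_l. *)
Lemma screen_low n f : (forall l, (n < l)%N -> A l f = 0) ->
  E f = \sum_(l < n) p l * A l.+1 f.
Proof.
move=> A_n; have [L0 /(_ (n + L0)%N (leq_addl _ _))[_ ->]] := screen_eventually f.
rewrite big_split_ord /= [X in _ + X]big1 ?addr0 // => l _.
by rewrite A_n ?mulr0 // ltnS leq_addr.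
Qed.

(** The operator kappa T - X_(-1), with a the element of the algebra by which
    X_(-1) multiplies. *)
Definition miura (a f : F) : F := kappa *: T f - a * f.

(** In the application a acts as X_(-1) and c is the pairing (b, X). *)
Definition pairing_with (a : F) (c : S) :=
  forall l f, A l.+1 (a * f) = a * A l.+1 f - c *: A l f.

Lemma ann_miura a c l f : pairing_with a c ->
  A l.+1 (miura a f) = miura a (A l.+1 f) + (kappa * l%:R + c) *: A l f.
Proof.
by move=> ac; rewrite linearB linearZ /= A_T ac /miura !scaleE; ring.
Qed.

(** The terms l p_l A_l coming from the commutators telescope against
    T p_l + p_1 p_l = (l+1) p_(l+1).  The right-hand side is the operator
    kappa T - a of the target module, whose translation operator has the extra
    term p_1 = b_(-1). *)
Lemma screen_miura a f : pairing_with a 0 ->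
  E (miura a f) = kappa *: (T (E f) + p 1%N * E f) - a * E f.
Proof.
move=> a0; have [L1 E1] := screen_eventually f.
have [L2 E2] := screen_eventually (miura a f).
pose L := (L1 + L2)%N.
have [AL ->] := E1 L (leq_addr _ _).
have [_ ->] := E2 L (leq_addl _ _).
transitivity (\sum_(l < L) (p l * miura a (A l.+1 f)) +
    kappa *: \sum_(l < L) l%:R *: (p l * A l f)).
  rewrite scaler_sumr -big_split; apply: eq_bigr => l _ /=.
  by rewrite (ann_miura _ _ a0) addr0 mulrDr -scalerAr scalerA.
have -> : \sum_(l < L) l%:R *: (p l * A l f) =
    \sum_(l < L) l.+1%:R *: (p l.+1 * A l.+1 f).
  case: {E1 E2} L AL => [|L] AL; first by rewrite !big_ord0.
  rewrite big_ord_recl scale0r add0r [RHS]big_ord_recr /= AL mulr0 scaler0 addr0.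
  by apply: eq_bigr.
rewrite scaler_sumr -big_split [T (\sum_(_ < _) _)]linear_sum !mulr_sumr -big_split.
rewrite [in RHS]scaler_sumr -sumrB.
apply: eq_bigr => l _ /=; rewrite T_leibniz /miura.
by rewrite scalerAl -p_T !scaleE; ring.
Qed.

(** The vectors on which the vertex operator of b has no singular part. *)
Definition vacuum_like (f : F) := forall l, A l.+1 f = 0.

Lemma screen_vacuum f : vacuum_like f -> E f = 0.
Proof. by move=> Af; rewrite (@screen_low 0) ?big_ord0 // => -[]. Qed.

Lemma vacuum_like_miura a f :
  pairing_with a 0 -> vacuum_like f -> vacuum_like (miura a f).
Proof.
move=> a0 Af l; rewrite (ann_miura _ _ a0) Af addr0 /miura linear0 scaler0 mulr0.
by case: l => [|l]; rewrite ?mulr0 ?scale0r ?Af ?scaler0 subr0 addr0.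
Qed.

(** The extra terms of the two operators cancel in degree l = 1; in higher degree
    they vanish on vacuum-like vectors. *)
Lemma vacuum_like_miuraD a1 a2 c f :
    pairing_with a1 c -> pairing_with a2 (- c) -> vacuum_like f ->
  vacuum_like (miura a1 f + miura a2 f).
Proof.
move=> ac1 ac2 Af l; rewrite linearD (ann_miura _ _ ac1) (ann_miura _ _ ac2) Af.
rewrite /miura linear0 scaler0 !mulr0 subr0 !add0r -scalerDl.
case: l => [|l]; last by rewrite Af scaler0.
by rewrite mulr0 !add0r subrr scale0r.
Qed.

(** On f' = sigma_2 sigma_1 f only A_1 f' = (kappa + 1) (a1 - a2) f and
    A_2 f' = - (kappa + 1) f survive, and E f' = A_1 f' + p_1 A_2 f'. *)
Lemma screen_miura_pair a1 a2 f :
    pairing_with a1 (kappa + 1) -> pairing_with a2 (- (kappa + 1)) ->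
    a1 - a2 = p 1%N -> vacuum_like f ->
  E (miura a2 (miura a1 f)) = 0.
Proof.
move=> ac1 ac2 a12 Af.
have miura0 a : miura a 0 = 0 by rewrite /miura linear0 scaler0 mulr0 subr0.
have A1 l : A l.+1 (miura a1 f) = if l == 0 then (kappa + 1) *: f else 0.
  rewrite (ann_miura _ _ ac1) Af miura0 add0r.
  by case: l => [|l]; rewrite ?mulr0 ?add0r ?A0 // Af scaler0.
rewrite (@screen_low 2) => [|[|[|[|l]]] // _]; last first.
  by rewrite (ann_miura _ _ ac2) !A1 /= miura0 scaler0 addr0.
rewrite !big_ord_recl big_ord0 /= p0 mul1r addr0.
rewrite !(ann_miura _ _ ac2) !A1 /= A0 miura0 add0r mulr0 add0r mulr1.
by rewrite /miura linearZ /= -a12 !scaleE; ring.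
Qed.

(** Put v_m = sigma^m 1.  The factor kappa (l-1) - kappa in the commutator of A_l
    with sigma vanishes for l = 2, so A_l v_m = 0 for all l >= 2, while
    A_1 v_m = - m kappa v_(m-1).  Then E v_m = A_1 v_m, and E (p_1 v) = - v on
    every such v. *)
Lemma screen_power a m :
    pairing_with a (- kappa) -> pairing_with (p 1%N) 1 ->
  E (iter m.+1 (miura a) 1) =
  (m.+1%:R * kappa) *: E (p 1%N * iter m (miura a) 1).
Proof.
move=> a_k p1; pose v m := iter m (miura a) 1.
have miura0 : miura a 0 = 0 by rewrite /miura linear0 scaler0 mulr0 subr0.
have A2 n l : A l.+2 (v n) = 0.
  elim: n l => [|n IHn] l; first exact: A_one.
  rewrite /v iterS -/(v n) (ann_miura _ _ a_k) IHn miura0 add0r.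
  case: l => [|l]; last by rewrite IHn scaler0.
  by rewrite mulr1 subrr scale0r.
have A1 n : A 1 (v n.+1) = - (n.+1%:R * kappa) *: v n.
  elim: n => [|n IHn]; rewrite /v iterS -/(v _) (ann_miura _ _ a_k) A0 mulr0 add0r.
    by rewrite A_one miura0 add0r mul1r.
  rewrite IHn /miura linearZ /= -scalerAr !scalerA [kappa * _]mulrC -scalerA -scalerBr.
  rewrite -/(miura a (v n)) -[miura a (v n)]/(v n.+1) -scalerDl.
  by congr (_ *: _); ring.
have E1 : E (v m.+1) = - (m.+1%:R * kappa) *: v m.
  rewrite (@screen_low 1) => [|[|[|l]] // _].
  by rewrite big_ord1 p0 mul1r A1.
rewrite -/(v m.+1) -/(v m) E1 scaleNr -scalerN; congr (_ *: _).
rewrite (@screen_low 2) => [|[|[|[|l]]] // _]; last first.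
  by rewrite p1 !A2 mulr0 scaler0 subr0.
rewrite !big_ord_recl big_ord0 /= p0 mul1r addr0 !p1 A2 mulr0 sub0r scale1r A0.
by rewrite scale1r mulrN addrAC subrr add0r.
Qed.

Lemma miuraZD a c f g : miura a (c *: f + g) = c *: miura a f + miura a g.
Proof. by rewrite /miura linearD linearZ /= !scaleE; ring. Qed.

HB.instance Definition _ a :=
  GRing.isLinear.Build S F F *:%R (miura a) (miuraZD a).

Lemma vacuum_likeD f g : vacuum_like f -> vacuum_like g -> vacuum_like (f + g).
Proof. by move=> Af Ag l; rewrite linearD Af Ag addr0. Qed.

Lemma vacuum_likeZ c f : vacuum_like f -> vacuum_like (c *: f).
Proof. by move=> Af l; rewrite linearZ /= Af scaler0. Qed.

Lemma vacuum_like0 : vacuum_like 0.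
Proof. by move=> l; rewrite linear0. Qed.

Lemma vacuum_like1 : vacuum_like 1.
Proof. exact: A_one. Qed.

Section Sums.

Variables (a : nat -> F) (c : nat -> S).

Let ED f g : E (f + g) = E f + E g. Proof. exact: linearD. Qed.
Let EZ b f : E (b *: f) = b *: E f. Proof. exact: linearZ. Qed.
Let E0 : E 0 = 0. Proof. exact: linear0. Qed.

Local Notation Om := (miura_sum c (fun j => miura (a j)) 1).

Lemma vacuum_like_miura_sum n :
    (forall j, (j <= n)%N -> pairing_with (a j) 0) ->
  forall r m, vacuum_like (Om n r m).
Proof.
elim: n => [|n IHn] a0 r m.
  apply: vacuum_likeZ; rewrite -scaler_nat; apply: vacuum_likeZ.
  elim: m => [|m IHm]; first exact: vacuum_like1.
  by apply: vacuum_like_miura => //; apply: a0.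
have {}IHn : forall r m, vacuum_like (Om n r m).
  by apply: IHn => j jn; apply: a0; apply: leqW.
apply: vacuum_likeD => //; case: r => [|r]; first exact: vacuum_like0.
apply: vacuum_likeD => //; case: m => [|m]; first exact: vacuum_like0.
by apply: vacuum_like_miura => //; apply: a0.
Qed.

(** Indices orthogonal to b do not affect the kernel of E. *)
Lemma screen_miura_sum_later n0 n R : (n0 <= n)%N ->
    (forall j, (n0 < j <= n)%N -> pairing_with (a j) 0) ->
    (forall r m, (r <= R)%N -> E (Om n0 r m) = 0) ->
  forall r m, (r <= R)%N -> E (Om n r m) = 0.
Proof.
move=> le_n a0 En0; elim: n le_n a0 => [|n IHn] le_n a0 r m r_R.
  by move: le_n En0; rewrite leqn0 => /eqP -> /(_ r m r_R).
have [n0E|n0E] := eqVneq n0 n.+1; first by rewrite -n0E; apply: En0.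
have le_n' : (n0 <= n)%N by rewrite -ltnS ltn_neqAle n0E.
have {}IHn : forall r m, (r <= R)%N -> E (Om n r m) = 0.
  by apply: IHn => // j /andP[n0j jn]; apply: a0; rewrite n0j leqW.
rewrite /= /miura_step ED IHn // add0r; case: r r_R => [|r] r_R.
  by rewrite E0.
rewrite ED IHn ?(ltnW r_R) // add0r; case: m => [|m]; first by rewrite E0.
rewrite screen_miura; last by apply: a0; rewrite ltnS le_n' leqnn.
by rewrite IHn ?(ltnW r_R) // linear0 !mulr0 addr0 scaler0 subr0.
Qed.

(** Two recursion steps expand to 1 + u (2 + t (s1 + s2))
    + u^2 (1 + t (s1 + s2) + t^2 s2 s1), and E kills each coefficient. *)
Lemma screen_step2 (s1 s2 : {linear F -> F}) (U : nat -> nat -> F) :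
    (forall r m, E (U r m) = 0) ->
    (forall r m, E (s1 (U r m)) + E (s2 (U r m)) = 0) ->
    (forall r m, E (s2 (s1 (U r m))) = 0) ->
  forall r m, E (miura_step s2 (miura_step s1 U) r m) = 0.
Proof.
move=> EU EUD EU2 r m.
have sD f g : E (s2 (f + g)) = E (s2 f) + E (s2 g) by rewrite linearD ED.
have s0 : E (s2 0) = 0 by rewrite linear0 E0.
rewrite /miura_step; case: r m => [|[|r]] [|[|m]];
  rewrite !(ED, sD, EU, EU2, E0, s0, addr0, add0r) ?EUD // addrA addrACA !EUD ?addr0 //.
Qed.

Lemma screen_miura_sum_pair i n :
    (i.+2 <= n)%N ->
    (forall j, (j <= n)%N -> j != i.+1 -> j != i.+2 -> pairing_with (a j) 0) ->
    pairing_with (a i.+1) (kappa + 1) -> pairing_with (a i.+2) (- (kappa + 1)) ->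
    a i.+1 - a i.+2 = p 1%N ->
  forall r m, E (Om n r m) = 0.
Proof.
move=> le_n a0 a1 a2 a12 r m.
apply: (screen_miura_sum_later le_n) (leqnn r) => [j|r' m' _].
  by case/andP=> ij jn; apply: a0; rewrite // gtn_eqF // ltnW.
have Om_i : forall r m, vacuum_like (Om i r m).
  apply: vacuum_like_miura_sum => j ji; apply: a0; last by rewrite ltn_eqF ?ltnS ?leqW.
    by rewrite (leq_trans ji) // (leq_trans _ le_n) // leqW.
  by rewrite ltn_eqF ?ltnS.
have EOm r1 m1 : E (Om i r1 m1) = 0 by apply: screen_vacuum.
have EOmD r1 m1 : E (miura (a i.+1) (Om i r1 m1)) + E (miura (a i.+2) (Om i r1 m1)) = 0.
  rewrite -ED; apply: screen_vacuum.
  exact: (vacuum_like_miuraD a1 a2).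
have EOm2 r1 m1 : E (miura (a i.+2) (miura (a i.+1) (Om i r1 m1))) = 0.
  exact: screen_miura_pair.
exact: (@screen_step2 (miura (a i.+1)) (miura (a i.+2))).
Qed.

(** Selecting the index 1 after r copies of the index 0, or taking r+1 copies of
    the index 0, gives with sigma_1 = sigma_0 + p_1 and v_m = sigma_0^m 1
      q ((r+1) kappa C(r,m-1) p_1 v_(m-1) - C(r+1,m) v_m),
    which E kills by [screen_power] because (r+1) C(r,m-1) = m C(r+1,m).  The
    factor q avoids dividing by kappa. *)
Lemma screen_miura_sum_repeated n (q : nat -> S) :
    (1 <= n)%N ->
    pairing_with (a 0) (- kappa) -> pairing_with (p 1%N) 1 -> a 1%N = a 0 - p 1%N ->
    (forall j, (1 < j <= n)%N -> pairing_with (a j) 0) ->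
    (forall r, (r < n)%N -> c r = r.+1%:R * kappa * q r /\
                            c r.+1 = - (r.+1%:R * kappa + 1) * q r) ->
  forall r m, (r <= n)%N -> E (Om n r m) = 0.
Proof.
move=> n1 a0 b1 a1 aj cq; apply: (screen_miura_sum_later n1) => // r m r_n.
rewrite /= /miura_step /miura_init /=; pose v m := iter m (miura (a 0)) 1.
have E1 : E 1 = 0 by apply: screen_vacuum; apply: vacuum_like1.
have Ev m' : E (v m'.+1) = (m'.+1%:R * kappa) *: E (p 1%N * v m').
  exact: screen_power.
have s1 f : miura (a 1%N) f = miura (a 0) f + p 1%N * f.
  by rewrite /miura a1 !scaleE; ring.
case: r r_n => [|r] r_n.
  rewrite addr0; case: m => [|m]; last by rewrite bin0n mulr0n scaler0 E0.
  by rewrite EZ /= E1 scaler0.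
have [-> ->] := cq r r_n; case: m => [|m].
  by rewrite !bin0 !mulr1n addr0 -scalerDl EZ E1 scaler0.
rewrite -[iter m.+1 _ _]/(v m.+1) -[iter m _ _]/(v m) -!scaler_nat s1 !linearZ /=.
rewrite -!scalerAr -[miura (a 0) (v m)]/(v m.+1); move: (v m.+1) (Ev m) => v1 Ev1.
rewrite !(ED, EZ) Ev1 !scalerA -!scalerDl; move: (E _) => u.
have binE : r.+1%:R * 'C(r, m)%:R = m.+1%:R * 'C(r.+1, m.+1)%:R :> S.
  by rewrite -!natrM mul_bin_diag.
transitivity ((kappa * q r *
    (r.+1%:R * 'C(r, m)%:R - m.+1%:R * 'C(r.+1, m.+1)%:R)) *: u).
  by congr (_ *: _); rewrite binS natrD; ring.
by rewrite binE subrr mulr0 scale0r.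
Qed.

End Sums.

End ScreeningCalculus.

(** * Oscillators on the Fock module of charge 0 *)

Lemma scaler_mulC (S : comUnitRingType) (A : comAlgType S) (c y : S) (g d : A) :
  y *: (g * (c *: d)) = c *: (y *: (g * d)).
Proof. by rewrite -scalerAr !scalerA mulrC. Qed.

Lemma scalerC (S : comUnitRingType) (V : lmodType S) (c y : S) (d : V) :
  y *: (c *: d) = c *: (y *: d).
Proof. by rewrite !scalerA mulrC. Qed.

Lemma sub_zeros (V : zmodType) (x y : V) : x = 0 -> y = 0 -> x - y = 0.
Proof. by move=> -> ->; rewrite subr0. Qed.

Section Oscillators.

Variables (N : nat) (S : comUnitRingType) (K : S).
Local Notation fock := {malg S[{cmonom (var_idx N)}]}.
Local Notation weight := (weight N S).

Lemma form_lin (u : weight) c v w : form K u (c *: v + w) = c * form K u v + form K u w.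
Proof. by rewrite formC formDl formZl !(formC K u). Qed.

Lemma form_w0 (a : weight) : form K a (wY N S 0) = 0.
Proof. by rewrite /wY mulr0z formC -(scale0r 0) formZl mul0r. Qed.

Lemma heis_lin (w a : weight) n c f g :
  heis K w a n (c *: f + g) = c *: heis K w a n f + heis K w a n g :> fock.
Proof.
case: n => [[|n]|n] /=; first by rewrite scalerDr !scalerA mulrC.
  by rewrite der_linear.
by rewrite mulrDr scalerAr.
Qed.

(** The element that acts as the mode a_(-n-1) by multiplication. *)
Definition osc (a : weight) (n : nat) : fock := \sum_i a 0 i *: var S (i, n).

(** The values on the variables of b_(n+1), and of the translation operator,
    as derivations. *)
Definition ann_delta (b : weight) (n : nat) (u : var_idx N) : fock :=
  if u.2 == n then (n.+1%:R * form K b (base S u.1))%:MP else 0.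

Definition trans_delta (u : var_idx N) : fock := u.2.+1%:R *: var S (u.1, u.2.+1).

Lemma trans_w0 f : trans K (wY N S 0) f = der trans_delta f.
Proof.
rewrite /trans -[LHS]/(der trans_delta f + osc (wY N S 0) 0 * f).
rewrite /osc big1 ?mul0r ?addr0 // => i _.
by rewrite /wY mulr0z mxE scale0r.
Qed.

Lemma scale_malgC (c d : S) : c *: (d%:MP : fock) = (c * d)%:MP.
Proof. by rewrite -mul_malgC -mpolyCM. Qed.

Lemma scale_malgCM (c d e : S) : c *: ((d * e)%:MP : fock) = d *: (c * e)%:MP.
Proof. by rewrite !scale_malgC mulrCA. Qed.

Lemma scale_malgC1 (c d e : S) : c *: ((d * e)%:MP : fock) = (d * (c * e)) *: 1.
Proof. by rewrite scale_malgC mulrCA -mul_malgC mulr1. Qed.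

Lemma der_const0 (f : fock) : der (fun _ => 0) f = 0.
Proof.
rewrite /der big1 // => mu _; rewrite /mon_der big1 ?scaler0 // => u _.
by rewrite mulr0 scaler0.
Qed.

Lemma mon_der_scale (c : S) (delta : var_idx N -> fock) mu :
  mon_der (fun u => c *: delta u) mu = c *: mon_der delta mu.
Proof.
rewrite /mon_der scaler_sumr; apply: eq_bigr => u _; exact: scaler_mulC.
Qed.

Lemma der_scale (c : S) (delta : var_idx N -> fock) f :
  der (fun u => c *: delta u) f = c *: der delta f.
Proof.
rewrite /der scaler_sumr; apply: eq_bigr => mu _.
by rewrite mon_der_scale scalerC.
Qed.

Lemma ann_deltaE b n i l : ann_delta b n (i, l) =
  if l == n then (n.+1%:R * form K b (base S i))%:MP else 0.
Proof. by []. Qed.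

Lemma trans_deltaE i l : trans_delta (i, l) = l.+1%:R *: var S (i, l.+1).
Proof. by []. Qed.

Lemma der_ann_delta delta b n (u : var_idx N) : der delta (ann_delta b n u) = 0.
Proof. by rewrite /ann_delta; case: ifP => _; rewrite ?derC ?linear0. Qed.

Lemma ann_comm b b' n l f :
  der (ann_delta b n) (der (ann_delta b' l) f) =
  der (ann_delta b' l) (der (ann_delta b n) f).
Proof.
apply/eqP; rewrite -subr_eq0 (@der_commutator _ _ _ _ (fun _ => 0)) ?der_const0 // => u.
exact: sub_zeros (der_ann_delta _ _ _ _) (der_ann_delta _ _ _ _).
Qed.

Lemma ann_trans0 b f :
  der (ann_delta b 0) (der trans_delta f) = der trans_delta (der (ann_delta b 0) f).
Proof.
apply/eqP; rewrite -subr_eq0 (@der_commutator _ _ _ _ (fun _ => 0)) ?der_const0 // => u.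
by rewrite der_ann_delta subr0 linearZ /= der_var /ann_delta /= scaler0.
Qed.

Lemma ann_transS b n f :
  der (ann_delta b n.+1) (der trans_delta f) =
  der trans_delta (der (ann_delta b n.+1) f) + n.+2%:R *: der (ann_delta b n) f.
Proof.
apply/eqP; rewrite addrC -subr_eq -der_scale; apply/eqP.
apply: der_commutator => -[i l].
rewrite der_ann_delta subr0 trans_deltaE linearZ /= der_var !ann_deltaE eqSS.
case: eqP => [->|_]; last by rewrite !scaler0.
exact: scale_malgCM.
Qed.

Lemma ann_osc b a n l :
  der (ann_delta b n) (osc a l) = if l == n then (n.+1%:R * form K b a) *: 1 else 0.
Proof.
rewrite /osc linear_sum /=.
under eq_bigr do rewrite linearZ /= der_var ann_deltaE.
case: eqP => _; last by rewrite big1 // => i _; rewrite scaler0.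
have {2}-> : a = \sum_i a 0 i *: base S i by exact: row_sum_delta.
have -> : form K b (\sum_i a 0 i *: base S i) = \sum_i a 0 i * form K b (base S i).
  elim/big_rec2: _ => [|i x y _ <-]; last by rewrite form_lin.
  by rewrite formC -(scale0r 0) formZl mul0r.
rewrite mulr_sumr scaler_suml; apply: eq_bigr => i _.
exact: scale_malgC1.
Qed.

Lemma trans_osc b n : der trans_delta (osc b n) = n.+1%:R *: osc b n.+1.
Proof.
rewrite /osc linear_sum scaler_sumr; apply: eq_bigr => i _.
by rewrite linearZ /= der_var trans_deltaE !scalerA mulrC.
Qed.

End Oscillators.

(** * The screening operators on the Fock module of charge 0 *)

Section ScreeningOnFock.

Variables (N : nat) (S : comUnitRingType) (K : S).
Hypothesis nat_unit : forall n, (0 < n)%N -> (n%:R : S) \is a GRing.unit.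
Local Notation fock := {malg S[{cmonom (var_idx N)}]}.
Variable i : 'I_N.+1.
Local Notation b := (base S i).
Local Notation w0 := (wY N S 0).

Definition ann_op (n : nat) (f : fock) : fock := - heis K w0 b n%:Z f.

Lemma ann_op_lin n c f g : ann_op n (c *: f + g) = c *: ann_op n f + ann_op n g.
Proof. by rewrite /ann_op heis_lin opprD scalerN. Qed.

HB.instance Definition _ n :=
  GRing.isLinear.Build S fock fock *:%R (ann_op n) (ann_op_lin n).

Lemma ann_op0 f : ann_op 0 f = 0.
Proof. by rewrite /ann_op /heis form_w0 scale0r oppr0. Qed.

Lemma ann_opS n f : ann_op n.+1 f = - der (ann_delta K b n) f.
Proof. by []. Qed.

Lemma leibnizN (A : comNzRingType) (D D' : A -> A) :
  leibniz D -> (forall f, D' f = - D f) -> leibniz D'.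
Proof. by move=> L E f g; rewrite !E L; ring. Qed.

Lemma ann_op_leibniz n : leibniz (ann_op n).
Proof.
case: n => [|n]; last exact: (leibnizN (@derM _ _ (ann_delta K b n)) (ann_opS n)).
by move=> f g; rewrite !ann_op0 mul0r mulr0 addr0.
Qed.

Lemma opp_linear_comm (V : lmodType S) (D1 D2 : {linear V -> V}) (x1 x2 : V -> V) :
    (forall f, D1 (D2 f) = D2 (D1 f)) -> (forall f, x1 f = - D1 f) ->
    (forall f, x2 f = - D2 f) ->
  forall f, x1 (x2 f) = x2 (x1 f).
Proof. by move=> D12 E1 E2 f; rewrite !(E1, E2) !linearN D12. Qed.

Lemma opp_linear_comm_scale (V : lmodType S) (D1 D2 T : {linear V -> V})
    (x1 x2 : V -> V) c :
    (forall f, D1 (T f) = T (D1 f) + c *: D2 f) -> (forall f, x1 f = - D1 f) ->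
    (forall f, x2 f = - D2 f) ->
  forall f, x1 (T f) = T (x1 f) + c *: x2 f.
Proof. by move=> D12 E1 E2 f; rewrite !E1 E2 D12 linearN scalerN opprD. Qed.

Lemma opp_linear_comm1 (V : lmodType S) (D1 T : {linear V -> V}) (x1 : V -> V) :
    (forall f, D1 (T f) = T (D1 f)) -> (forall f, x1 f = - D1 f) ->
  forall f, x1 (T f) = T (x1 f).
Proof. by move=> D1T E1 f; rewrite !E1 D1T linearN. Qed.

Lemma ann_op_comm n l f : ann_op n (ann_op l f) = ann_op l (ann_op n f).
Proof.
case: n l => [|n] [|l].
- by [].
- by rewrite !ann_op0 linear0.
- by rewrite !ann_op0 linear0.
- exact: (opp_linear_comm (@ann_comm _ _ K b b n l) (ann_opS n) (ann_opS l)).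
Qed.

Definition fock_trans : {linear fock -> fock} :=
  GRing.Linear.clone _ _ _ _ (der (@trans_delta N S)) _.

Lemma ann_op_trans n f :
  ann_op n.+1 (fock_trans f) = fock_trans (ann_op n.+1 f) + n.+1%:R *: ann_op n f.
Proof.
case: n f => [|n]; last first.
  exact: (opp_linear_comm_scale (@ann_transS _ _ K b n) (ann_opS n.+1) (ann_opS n)).
move=> f; rewrite ann_op0 scaler0 addr0.
exact: (opp_linear_comm1 (T := fock_trans) (@ann_trans0 _ _ K b) (ann_opS 0)).
Qed.

Lemma ann_op_osc a n :
  ann_op n (osc a 0) = if n == 1%N then - form K b a *: 1 else 0.
Proof.
case: n => [|n]; first exact: ann_op0.
rewrite ann_opS ann_osc eqSS eq_sym; case: eqP => [->|_]; last by rewrite oppr0.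
by rewrite mul1r scaleNr.
Qed.

Definition cre_op (n : nat) (f : fock) : fock := heis K (w0 + b) b (- n%:Z) f.

Lemma cre_op_lin n c f g : cre_op n (c *: f + g) = c *: cre_op n f + cre_op n g.
Proof. exact: heis_lin. Qed.

HB.instance Definition _ n :=
  GRing.isLinear.Build S fock fock *:%R (cre_op n) (cre_op_lin n).

Definition cre_elt (n : nat) : fock :=
  if n is n'.+1 then osc b n' else form K b (w0 + b) *: 1.

Lemma cre_opE n f : cre_op n f = cre_elt n * f.
Proof. by case: n => [|n] //; rewrite /cre_op /= -scalerAl mul1r. Qed.

Lemma trans_cre_elt n : (0 < n)%N -> fock_trans (cre_elt n) = n%:R *: cre_elt n.+1.
Proof. by case: n => // n _; exact: trans_osc. Qed.

Lemma fock_trans_leibniz : leibniz fock_trans.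
Proof. exact: derM. Qed.

Lemma fock_trans1 : fock_trans 1 = 0.
Proof. exact: der1. Qed.

Definition ann_ser (l : nat) (f : fock) : fock := exp_series ann_op l f.

Lemma ann_ser_lin l c f g : ann_ser l (c *: f + g) = c *: ann_ser l f + ann_ser l g.
Proof. exact: (ann_series_linear nat_unit ann_op_comm). Qed.

HB.instance Definition _ n :=
  GRing.isLinear.Build S fock fock *:%R (ann_ser n) (ann_ser_lin n).

Definition screen (f : fock) : fock := lattice_mode K i 0 0 f.

Local Notation p := (creation_coef cre_op).

(** As (b, 0 Y) = 0, the coefficient of z^(-1) pairs z^(l-1) with z^(-l); the
    conformal weight of f bounds the l with A_l f nonzero. *)
Lemma screenE f : exists2 L, forall l, (L <= l)%N -> ann_ser l f = 0 &
  screen f = \sum_(l < L) p l * ann_ser l.+1 f.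
Proof.
have A0 l : (wt f < l)%N -> ann_ser l f = 0 := @exp_coef_ann_eq0 N S K w0 b l f.
exists (wt f).+1; first exact: A0.
rewrite big_ord_recr /= [X in _ + X](_ : _ = 0) ?addr0; last by rewrite A0 ?mulr0.
rewrite /screen /lattice_mode big_ord_recl.
have -> : pairY i 0 = 0 by rewrite /pairY if_same.
rewrite add0r; apply: eq_bigr => l _.
have -> : (lift ord0 l + 0 + 0 - 1)%N = l by rewrite lift0 !addn0 subn1.
exact: (exp_series_creation nat_unit cre_opE).
Qed.

Lemma ann_op_one n : ann_op n 1 = 0.
Proof. by case: n => [|n]; rewrite ?ann_op0 // ann_opS der1 oppr0. Qed.

Lemma ann_ser0 f : ann_ser 0 f = f.
Proof. exact: exp_series0. Qed.

Lemma ann_ser_one l : ann_ser l.+1 1 = 0.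
Proof. exact: (ann_series_const nat_unit ann_op_comm (ltn0Sn l) ann_op_one). Qed.

Lemma ann_ser_trans l f :
  ann_ser l.+1 (fock_trans f) = fock_trans (ann_ser l.+1 f) + l%:R *: ann_ser l f.
Proof. exact: (ann_series_trans nat_unit ann_op_comm ann_op0 ann_op_trans). Qed.

Let A (l : nat) : {linear fock -> fock} := GRing.Linear.clone _ _ _ _ (ann_ser l) _.

Lemma pairing_osc a : pairing_with A (osc a 0) (form K b a).
Proof.
move=> l f.
exact: (ann_series_mul nat_unit ann_op_leibniz ann_op_comm f (ann_op_osc a) l).
Qed.

Lemma creation_coef1_osc : p 1%N = osc b 0.
Proof. exact: (creation_coef1 nat_unit cre_opE). Qed.

Lemma fock_trans_coef l : fock_trans (p l) + p 1%N * p l = l.+1%:R *: p l.+1.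
Proof.
rewrite creation_coef1_osc.
exact: (creation_coef_trans nat_unit cre_opE fock_trans_leibniz fock_trans1
  trans_cre_elt).
Qed.

Lemma oscB (a a' : weight N S) n : osc a n - osc a' n = osc (a - a') n :> fock.
Proof.
rewrite /osc -sumrB; apply: eq_bigr => j _.
by rewrite -scalerBl !mxE.
Qed.

Section FockSums.

Variables (kappa : S) (c : nat -> S) (x : nat -> weight N S).

Local Notation fock_sum :=
  (miura_sum c (fun l => miura kappa fock_trans (osc (x l) 0)) 1).

Lemma screen_fock_pair j n : (j.+2 <= n)%N ->
    (forall l, (l <= n)%N -> l != j.+1 -> l != j.+2 -> form K b (x l) = 0) ->
    form K b (x j.+1) = kappa + 1 -> form K b (x j.+2) = - (kappa + 1) ->
    x j.+1 - x j.+2 = b ->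
  forall r m, screen (fock_sum n r m) = 0.
Proof.
move=> jn x0 x1 x2 x12.
apply: (screen_miura_sum_pair ann_ser0 ann_ser_one ann_ser_trans (creation_coef0 cre_op)
  fock_trans_leibniz fock_trans_coef screenE c jn).
- by move=> l ln l1 l2; rewrite -(x0 l) //; exact: pairing_osc.
- by rewrite -x1; exact: pairing_osc.
- by rewrite -x2; exact: pairing_osc.
- by rewrite creation_coef1_osc oscB x12.
Qed.

Lemma screen_fock_repeated n (q : nat -> S) : (1 <= n)%N ->
    form K b (x 0) = - kappa -> form K b b = 1 -> x 1%N = x 0 - b ->
    (forall l, (1 < l <= n)%N -> form K b (x l) = 0) ->
    (forall r, (r < n)%N -> c r = r.+1%:R * kappa * q r /\
                            c r.+1 = - (r.+1%:R * kappa + 1) * q r) ->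
  forall r m, (r <= n)%N -> screen (fock_sum n r m) = 0.
Proof.
move=> n1 x0 bb x1 xl cq.
apply: (screen_miura_sum_repeated ann_ser0 ann_ser_one ann_ser_trans
  (creation_coef0 cre_op) fock_trans_leibniz fock_trans_coef screenE n1) cq.
- by rewrite -x0; exact: pairing_osc.
- by rewrite creation_coef1_osc -bb; exact: pairing_osc.
- by rewrite creation_coef1_osc oscB x1.
- by move=> l ln; rewrite -(xl l) //; exact: pairing_osc.
Qed.

End FockSums.

End ScreeningOnFock.

(** * The weights X_j and their pairings *)

Section Weights.

Variables (N : nat) (S : comUnitRingType) (K : S).
Hypothesis N2 : (1 < N)%N.
Hypothesis nat_unit : forall n, (0 < n)%N -> (n%:R : S) \is a GRing.unit.

Local Notation A i := (vA N S i).
Local Notation Q := (vQ N S).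
Local Notation X j := (X N K j).

Lemma XS j : (0 < j < N)%N -> X j.+1 = X j - A j.
Proof.
case: j => // j /andP[_ jN]; rewrite /Defs.X big_nat_recr //= (big_ltn jN).
rewrite natrB ?(ltnW jN) // mulrBl divrr ?nat_unit ?(ltn_trans _ N2) //.
rewrite scalerBl scale1r; set u := _ *: vY _ _; set v := \sum_(1 <= l < _) _.
set w := \sum_(_ <= l < N) _; set x := _ *: A j.+1.
by apply/rowP => k; rewrite !mxE; ring.
Qed.

Lemma X0E : X 0 = X 1 + Q.
Proof. by rewrite /Defs.X big_nil subr0 addrAC. Qed.

Lemma form_A_A i l : (0 < i < N)%N -> (0 < l < N)%N -> form K (A i) (A l) =
  (if l == i then 2 * K else 0) - (if l == i.+1 then K else 0)
    - (if l.+1 == i then K else 0).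
Proof.
move=> /andP[i0 iN] /andP[l0 lN].
rewrite form_base /gram !iA_neqY // -!val_eqE /= !iA_val //.
rewrite [i == 0%N]gtn_eqF // eq_sym; case: (eqVneq l i) => [->|li].
  by rewrite ltn_eqF // gtn_eqF // !subr0.
rewrite [i == l.+1]eq_sym sub0r.
case: (eqVneq l i.+1) => [->|_]; rewrite ?orbT ?orbF; last first.
  by rewrite oppr0 add0r; case: ifP; rewrite ?oppr0.
by rewrite gtn_eqF ?subr0.
Qed.

(** The coefficients (N - l)/N are affine in l, so the Cartan matrix kills them
    except at the end l = 1. *)
Lemma form_A_X1 i : (0 < i < N)%N -> form K (A i) (X 1) = if i == 1%N then K else 0.
Proof.
move=> iN; have [i0 iN'] := andP iN; have N0 : (N%:R : S) \is a GRing.unit.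
  by rewrite nat_unit // ltnW.
rewrite /Defs.X big_nil subr0 formC formDl formZl form_YA // mulr0 add0r.
set g := fun l : nat => (N - l)%:R / N%:R : S.
have -> : form K (\sum_(1 <= l < N) g l *: A l) (A i) =
    \sum_(1 <= l < N) g l * form K (A i) (A l).
  elim/big_rec2: _ => [|l x y _ <-]; last by rewrite formDl formZl (formC K (A l)).
  by rewrite -(scale0r 0) formZl mul0r.
have ind (a : nat) (d : S) : \sum_(1 <= l < N) g l * (if l == a then d else 0) =
    if (0 < a < N)%N then g a * d else 0.
  transitivity (\sum_(1 <= l < N | l == a) g l * d); last by rewrite big_nat1_eq.
  rewrite [RHS]big_mkcond; apply: eq_bigr => l _.
  by case: ifP; rewrite ?mulr0.
transitivity (\sum_(1 <= l < N) (g l * (if l == i then 2 * K else 0)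
   - g l * (if l == i.+1 then K else 0) - g l * (if l == i.-1 then K else 0))).
  apply: eq_big_nat => l lN; rewrite form_A_A // !mulrBr.
  by congr (_ - _ * _); case: i i0 {iN iN' ind}.
rewrite !sumrB !ind iN.
(* for i = N - 1 the neighbour A_N does not exist, but its weight (N - N)/N is 0 *)
have -> : (if (0 < i.+1 < N)%N then g i.+1 * K else 0) = g i.+1 * K.
  case: ifP => //=; rewrite ltnNge => /negbFE Ni; rewrite /g.
  have -> : (N - i.+1)%N = 0%N by apply/eqP; rewrite subn_eq0.
  by rewrite !mul0r.
have gE l : (l <= N)%N -> g l = 1 - l%:R / N%:R.
  by move=> lN; rewrite /g natrB // mulrBl divrr.
case: i i0 iN iN' => // i _ _ iN; rewrite !gE ?(ltnW iN) //= ?(ltnW (ltnW iN)) //.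
by case: i iN => [|i] iN /=; ring.
Qed.

Lemma formDr (u v w : weight N S) : form K u (v + w) = form K u v + form K u w.
Proof. by rewrite formC formDl !(formC K u). Qed.

Lemma formBr (u v w : weight N S) : form K u (v - w) = form K u v - form K u w.
Proof. by rewrite addrC -scaleN1r form_lin mulN1r addrC. Qed.

Lemma form_A_X i j : (0 < i < N)%N -> (j <= N)%N ->
  form K (A i) (X j) = (if j == i then K else 0) - (if j == i.+1 then K else 0).
Proof.
move=> iN; have [i0 iN'] := andP iN; case: j => [_|j].
  rewrite X0E formDr form_A_X1 // formC [0%N == i]ltn_eqF //= subr0.
  case: (eqVneq i 1%N) => [->|i1]; first by rewrite form_QA1 // subrr.
  by rewrite form_QA ?addr0 // ltn_neqAle eq_sym i1 i0.
elim: j => [_|j IHj jN].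
  by rewrite form_A_X1 // eq_sym eqSS [0%N == _]ltn_eqF // subr0.
rewrite XS // formBr form_A_A // IHj ?(ltnW jN) //.
by rewrite [j.+2 == i.+1]eqSS; case: (j.+1 == i); ring.
Qed.

Lemma form_Q_X j : (j <= N)%N -> form K Q (X j) =
  if j == 0%N then 1 - K else if j == 1%N then - K else 0.
Proof.
have Q1 : form K Q (X 1) = - K.
  rewrite /Defs.X big_nil subr0 formDr formC formZl formC form_QY // mulr1.
  rewrite big_ltn // formDr formC formZl formC form_QA1 //.
  rewrite [T in _ + (_ + T)](_ : _ = 0) ?addr0; last first.
    rewrite big_nat; elim/big_rec: _ => [|l x lN].
      by rewrite formC -(scale0r 0) formZl mul0r.
    by rewrite form_lin form_QA // mulr0 add0r.
  rewrite natrB ?(ltnW N2) // mulrBl divrr ?nat_unit ?(ltnW N2) //; ring.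
case: j => [_|[_|[|j] jN]].
- by rewrite X0E formDr Q1 form_QQ // addrC.
- exact: Q1.
- by rewrite XS // formBr Q1 form_QA1 // subrr.
- elim: j jN => [|j IHj] jN; rewrite XS ?formBr ?form_QA //.
    by rewrite XS ?formBr ?Q1 ?form_QA1 ?subrr ?subr0 // ltnW.
  by rewrite IHj ?subrr // ltnW.
Qed.

End Weights.

(** * The vector W'_m as a vector of the Fock module *)

Section ElemSymMorphism.

Variables (V V' : zmodType) (g : V -> V').
Hypothesis g_add : forall u v, g (u + v) = g u + g v.
Hypothesis g0 : g 0 = 0.
Variables (s : nat -> V -> V) (s' : nat -> V' -> V').
Hypothesis g_s : forall j v, g (s j v) = s' j (g v).

Lemma elem_sym_morph m (js : seq nat) v :
  g (elem_sym m (map s js) v) = elem_sym m (map s' js) (g v).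
Proof.
rewrite /elem_sym /subset_comp (big_morph g g_add g0) !size_map.
apply: eq_bigr => A _; elim: (rev _) => //= i l <-.
by rewrite !(nth_map 0%N) ?ltn_ord.
Qed.

End ElemSymMorphism.

Lemma elem_sym_zero (V : zmodType) (s : nat -> V -> V) m js :
  (forall j, s j 0 = 0) -> elem_sym m (map s js) 0 = 0.
Proof.
move=> s0; rewrite /elem_sym /subset_comp size_map big1 // => A _.
by elim: (rev _) => //= i l ->; rewrite (nth_map 0%N) ?ltn_ord.
Qed.

Section DerivationTransport.

Variables (S S' : comUnitRingType) (F : comAlgType S) (F' : comAlgType S').
Variables (I : Type) (x : I -> F) (x' : I -> F').
Hypothesis gen_ind : forall P : F -> Prop,
    P 1 -> (forall f g, P f -> P g -> P (f + g)) ->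
    (forall c f, P f -> P (c *: f)) -> (forall u f, P f -> P (x u * f)) ->
  forall f, P f.
Variables (rho : S -> S') (phi : F -> F').
Hypothesis phiD : forall f g, phi (f + g) = phi f + phi g.
Hypothesis phiZ : forall c f, phi (c *: f) = rho c *: phi f.
Hypothesis phi1 : phi 1 = 1.
Hypothesis phiM : forall u f, phi (x u * f) = x' u * phi f.

Lemma derivation_transport (D : {linear F -> F}) (D' : {linear F' -> F'})
    (tau : I -> I) (d : I -> S) :
    leibniz D -> leibniz D' -> D 1 = 0 -> D' 1 = 0 ->
    (forall u, D (x u) = d u *: x (tau u)) ->
    (forall u, D' (x' u) = rho (d u) *: x' (tau u)) ->
  forall f, phi (D f) = D' (phi f).
Proof.
move=> L L' D1 D'1 Dx D'x f; elim/gen_ind: f => [|f g IHf IHg|c f IHf|u f IHf].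
- by rewrite phi1 D1 D'1; apply: (addrI (phi 0)); rewrite -phiD !addr0.
- by rewrite linearD !phiD linearD IHf IHg.
- by rewrite linearZ /= !phiZ linearZ /= IHf.
- by rewrite L phiM L' phiD Dx D'x -!scalerAl phiZ !phiM IHf.
Qed.

End DerivationTransport.

Section HalfLatticeSums.

Variables (N : nat) (S : comUnitRingType) (K : S).
Hypothesis N2 : (1 < N)%N.
Hypothesis nat_unit : forall n, (0 < n)%N -> (n%:R : S) \is a GRing.unit.
Local Notation fock := {malg S[{cmonom (var_idx N)}]}.

Definition fock_sigma (j : nat) : fock -> fock :=
  miura (K - 1) (@fock_trans N S) (osc (X N K j) 0).

Lemma fock_sigma_lin j a f g :
  fock_sigma j (a *: f + g) = a *: fock_sigma j f + fock_sigma j g.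
Proof. exact: miuraZD. Qed.

Lemma sigma_mcoeff j (v : halflat N S) n : (sigma K j v)@_n =
  (K - 1) *: trans K (wY N S n) v@_n - heis K (wY N S n) (X N K j) (-1) v@_n.
Proof. by rewrite mcoeffB scaleVE transVE heisVE. Qed.

Lemma sigma_mcoeff0 j (v : halflat N S) : (sigma K j v)@_0 = fock_sigma j v@_0.
Proof. by rewrite sigma_mcoeff trans_w0. Qed.

(** The expression W'_m on the charge 0 part with arbitrary coefficients c_k, so
    that it can be compared over C[K] and over its localization. *)
Definition weighted_esym (c : nat -> S) (m : nat) : fock := \sum_(k < N.+1) c k *:
  \sum_(I : {set 'I_N} | #|I| == (N - k)%N)
    elem_sym m (map fock_sigma (nseq k 0%N ++ [seq (i : 'I_N).+1 | i <- enum I])) 1.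

Lemma weighted_esymE c m : weighted_esym c m = miura_sum c fock_sigma 1 N N m.
Proof.
rewrite (miura_sumE c fock_sigma_lin); apply: eq_bigr => k _; congr (_ *: _).
by apply: eq_bigr => I _; rewrite map_cat map_nseq -map_comp.
Qed.

Definition W'_coef (k : nat) : S :=
  (-1) ^+ k * \prod_(1 <= j < k.+1) ((j%:R * (K - 1) + 1) / (j%:R * (K - 1))).

Lemma W'_mcoeff m n :
  (W' N K m)@_n = if n == 0 then weighted_esym W'_coef m else 0.
Proof.
rewrite /W' raddf_sum /=.
have E k (I : {set 'I_N}) :
    nseq k (sigma K 0) ++ [seq sigma K (i : 'I_N).+1 | i <- enum I] =
    map (sigma (N := N) K) (nseq k 0%N ++ [seq (i : 'I_N).+1 | i <- enum I]).
  by rewrite map_cat map_nseq -map_comp.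
have vacE : (vac N S)@_n = if n == 0 then 1 else 0.
  by rewrite mcoeffU eq_sym; case: eqP.
case: eqP vacE => [->|_] vacE; last first.
  apply: big1 => k _; rewrite scaleVE raddf_sum /= [U in _ *: U]big1 ?scaler0 // => I _.
  pose s j (f : fock) :=
    (K - 1) *: trans K (wY N S n) f - heis K (wY N S n) (X N K j) (-1) f.
  rewrite E; have := @elem_sym_morph _ _ (mcoeff n) (mcoeffD n) (mcoeff0 n)
    (sigma (N := N) K) s (fun j v => sigma_mcoeff j v n) m.
  move=> ->; rewrite vacE; apply: elem_sym_zero => j.
  by rewrite /s trans0 heis0 scaler0 subr0.
apply: eq_bigr => k _; rewrite scaleVE raddf_sum /=; congr (_ *: _).
apply: eq_bigr => I _; rewrite E.
have := @elem_sym_morph _ _ (mcoeff 0) (mcoeffD 0) (mcoeff0 0)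
  (sigma (N := N) K) fock_sigma sigma_mcoeff0 m.
by move=> ->; rewrite mcoeffUU.
Qed.

(** The coefficients of W'_m multiplied by prod_(1 <= j <= N) j (K - 1). *)
Definition cleared_coef (k : nat) : S :=
  (-1) ^+ k * (\prod_(1 <= j < k.+1) (j%:R * (K - 1) + 1)
             * \prod_(k.+1 <= j < N.+1) (j%:R * (K - 1))).

Lemma screen_cleared_A i m : (1 <= i <= N.-1)%N ->
  screen K (iA N i) (weighted_esym cleared_coef m) = 0.
Proof.
case: i => // i /andP[_ iN]; have iN' : (i.+1 < N)%N by rewrite -ltn_predRL.
have iN2 : (0 < i.+1 < N)%N by [].
rewrite weighted_esymE; apply: (@screen_fock_pair N S K nat_unit (iA N i.+1)
  (K - 1) cleared_coef (X N K) i N) => //.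
- move=> l lN l1 l2.
  by rewrite (form_A_X K N2 nat_unit iN2 lN) (negbTE l1) (negbTE l2) subrr.
- by rewrite (form_A_X K N2 nat_unit iN2) 1?ltnW // eqxx ltn_eqF // subr0 subrK.
- by rewrite (form_A_X K N2 nat_unit iN2) // eqxx gtn_eqF // sub0r subrK.
- by rewrite (XS K N2 nat_unit iN2) opprB addrCA subrr addr0.
Qed.

Lemma screen_cleared_Q m : screen K (iQ N) (weighted_esym cleared_coef m) = 0.
Proof.
rewrite weighted_esymE.
have [q cq] : exists q : nat -> S, forall r, (r < N)%N ->
    cleared_coef r = r.+1%:R * (K - 1) * q r /\
    cleared_coef r.+1 = - (r.+1%:R * (K - 1) + 1) * q r.
  exists (fun r => (-1) ^+ r * (\prod_(1 <= j < r.+1) (j%:R * (K - 1) + 1)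
             * \prod_(r.+2 <= j < N.+1) (j%:R * (K - 1)))) => r rN.
  rewrite /cleared_coef; split; first by rewrite (big_ltn (m := r.+1)) //; ring.
  by rewrite big_nat_recr //= exprS; ring.
apply: (@screen_fock_repeated N S K nat_unit (iQ N)
  (K - 1) cleared_coef (X N K) N q) => //.
- exact: ltnW.
- by rewrite (form_Q_X K N2 nat_unit) // opprB.
- exact: form_QQ.
- by rewrite (X0E N K) addrK.
- by move=> [|[|l]] // /andP[_ lN]; rewrite (form_Q_X K N2 nat_unit).
Qed.

Lemma cleared_inW m : inW K (<< weighted_esym cleared_coef m *g 0 >> : halflat N S).
Proof.
have screen_w i : screen K i (weighted_esym cleared_coef m) = 0 ->
    screening K i (<< weighted_esym cleared_coef m *g 0 >> : halflat N S) = 0.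
  move=> wi; apply/malgP => n; rewrite screeningE mcoeffU mcoeff0.
  by case: eqP => [<-|_]; [rewrite mulr1n; exact: wi | rewrite mulr0n lattice_mode0].
split=> [|i iN]; apply: screen_w; first exact: screen_cleared_Q.
exact: screen_cleared_A.
Qed.

End HalfLatticeSums.

(** * Change of the base ring *)

Lemma miura_transport (S S' : comUnitRingType) (F : comAlgType S) (F' : comAlgType S')
    (rho : {rmorphism S -> S'}) (phi : F -> F')
    (T : {linear F -> F}) (T' : {linear F' -> F'}) (a : F) (a' : F') (kappa : S) :
    (forall f g, phi (f + g) = phi f + phi g) ->
    (forall c f, phi (c *: f) = rho c *: phi f) ->
    (forall f, phi (T f) = T' (phi f)) -> (forall f, phi (a * f) = a' * phi f) ->
  forall f, phi (miura kappa T a f) = miura (rho kappa) T' a' (phi f).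
Proof.
move=> phiD phiZ phiT phia f.
by rewrite /miura -!scaleN1r phiD !phiZ phiT phia rmorphN1.
Qed.

Section CoefficientMap.

Variables (N : nat) (S S' : comUnitRingType) (rho : {rmorphism S -> S'}).
Local Notation fock := {malg S[{cmonom (var_idx N)}]}.
Local Notation fock' := {malg S'[{cmonom (var_idx N)}]}.

(* kept abstract: only its coefficients matter *)
Variable coef_map : fock -> fock'.
Hypothesis coef_mapE : forall f mu, (coef_map f)@_mu = rho f@_mu.

Lemma coef_mapD f g : coef_map (f + g) = coef_map f + coef_map g.
Proof. by apply/malgP => mu; rewrite mcoeffD !coef_mapE mcoeffD rmorphD. Qed.

Lemma coef_map0 : coef_map 0 = 0.
Proof. by apply/malgP => mu; rewrite coef_mapE !mcoeff0 rmorph0. Qed.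

Lemma coef_mapZ c f : coef_map (c *: f) = rho c *: coef_map f.
Proof. by apply/malgP => mu; rewrite [RHS]mcoeffZ !coef_mapE mcoeffZ rmorphM. Qed.

Lemma coef_mapU mu : coef_map << mu >> = << mu >>.
Proof.
apply/malgP => nu; rewrite coef_mapE !mcoeffU.
by case: eqP; rewrite ?rmorph1 ?rmorph0.
Qed.

Lemma coef_map_sum (J : Type) (r : seq J) (G : J -> fock) :
  coef_map (\sum_(j <- r) G j) = \sum_(j <- r) coef_map (G j).
Proof. exact: (big_morph _ coef_mapD coef_map0). Qed.

Lemma coef_map_monom_mul mu f : coef_map (<< mu >> * f) = << mu >> * coef_map f.
Proof.
have E g : coef_map g = \sum_(nu <- msupp g) rho g@_nu *: << nu >>.
  rewrite {1}(malg_sumE g) coef_map_sum; apply: eq_bigr => nu _.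
  by rewrite coef_mapZ coef_mapU.
rewrite {1}(malg_sumE f) mulr_sumr coef_map_sum E mulr_sumr.
apply: eq_bigr => nu _; rewrite -!scalerAr coef_mapZ; congr (_ *: _).
by rewrite !malgUM coef_mapU.
Qed.

(** Both translation operators are derivations that send the variable (i, n) to
    (n+1) times the variable (i, n+1). *)
Lemma coef_map_trans f :
  coef_map (@fock_trans N S f) = @fock_trans N S' (coef_map f).
Proof.
apply: (@derivation_transport S S' _ _ (var_idx N) (@var S _) (@var S' _) (@pol_ind S _)
  rho coef_map coef_mapD coef_mapZ (coef_mapU _) (fun u => coef_map_monom_mul (ucm u))
  (@fock_trans N S) (@fock_trans N S') (fun u => (u.1, u.2.+1)) (fun u => u.2.+1%:R)
  (@fock_trans_leibniz N S) (@fock_trans_leibniz N S')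
  (@fock_trans1 N S) (@fock_trans1 N S')) => u.
  exact: der_var.
by rewrite rmorph_nat; exact: der_var.
Qed.

Lemma coef_map_osc (a : weight N S) n f :
  coef_map (osc a n * f) = osc (map_mx rho a) n * coef_map f.
Proof.
rewrite /osc !mulr_suml coef_map_sum; apply: eq_bigr => i _.
rewrite -!scalerAl coef_mapZ mxE; congr (_ *: _); exact: coef_map_monom_mul.
Qed.

Hypothesis nat_unit : forall n, (0 < n)%N -> (n%:R : S) \is a GRing.unit.
Hypothesis N0 : (0 < N)%N.

Lemma map_X K j : map_mx rho (X N K j) = X N (rho K) j.
Proof.
have rhoV n : rho (n%:R / N%:R) = n%:R / N%:R.
  by rewrite rmorphM rmorphV ?nat_unit //= !rmorph_nat.
have rhoK : rho (K / N%:R) = rho K / N%:R.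
  by rewrite rmorphM rmorphV ?nat_unit //= rmorph_nat.
have map_base i : map_mx rho (base S i) = base S' i by rewrite map_delta_mx.
have map_sum m n (c : nat -> nat) :
    map_mx rho (\sum_(m <= l < n) ((c l)%:R / N%:R) *: vA N S l)
    = \sum_(m <= l < n) ((c l)%:R / N%:R) *: vA N S' l.
  rewrite map_mx_sum; apply: eq_bigr => l _.
  by rewrite map_mxZ rhoV map_base.
by case: j => [|j];
  rewrite /X !map_mxD ?map_mxN map_mxZ rmorphN rhoK !map_base !map_sum.
Qed.

Lemma coef_map_sigma K j f :
  coef_map (fock_sigma K j f) = fock_sigma (rho K) j (coef_map f).
Proof.
have -> : fock_sigma (rho K) j =
    miura (rho (K - 1)) (@fock_trans N S') (osc (map_mx rho (X N K j)) 0).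
  by rewrite map_X rmorphB rmorph1.
exact (@miura_transport S S' _ _ rho coef_map (@fock_trans N S) (@fock_trans N S') _ _ _
  coef_mapD coef_mapZ coef_map_trans (coef_map_osc (X N K j) 0) f).
Qed.

Lemma coef_map_power_sym K c m :
  coef_map (weighted_esym N K c m) = weighted_esym N (rho K) (fun k => rho (c k)) m.
Proof.
rewrite /weighted_esym coef_map_sum; apply: eq_bigr => k _.
rewrite coef_mapZ; congr (_ *: _).
rewrite (big_morph coef_map coef_mapD coef_map0); apply: eq_bigr => I _.
rewrite (elem_sym_morph coef_mapD coef_map0 (coef_map_sigma K)); congr elem_sym.
exact: coef_mapU.
Qed.

End CoefficientMap.

Lemma cleared_coefE (N : nat) (S S' : comUnitRingType)
    (rho : {rmorphism S -> S'}) (K : S) k :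
    (forall j, (0 < j)%N -> (j%:R * (rho K - 1)) \is a GRing.unit) -> (k <= N)%N ->
  rho (cleared_coef N K k) =
  (\prod_(1 <= j < N.+1) (j%:R * (rho K - 1))) * W'_coef (rho K) k.
Proof.
move=> unit_j kN; have rhoj j : rho (j%:R * (K - 1)) = j%:R * (rho K - 1).
  by rewrite rmorphM rmorph_nat rmorphB rmorph1.
rewrite /cleared_coef /W'_coef !rmorphM rmorphXn rmorphN1 !rmorph_prod.
rewrite [RHS]mulrCA; congr (_ * _); rewrite (@big_cat_nat _ _ _ k.+1 1 N.+1) //=.
rewrite mulrAC; congr (_ * _); last by apply: eq_bigr => j _; rewrite rhoj.
rewrite -big_split /=; apply: eq_big_nat => j /andP[j0 _].
by rewrite rmorphD rmorph1 rhoj mulrCA divrr ?unit_j // mulr1.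
Qed.

Lemma W'_base_change (N : nat) (S S' : comUnitRingType) (rho : {rmorphism S -> S'})
    (K : S) (m : nat) :
    (0 < N)%N -> (forall n, (0 < n)%N -> (n%:R : S) \is a GRing.unit) ->
    (forall j, (0 < j)%N -> (j%:R * (rho K - 1)) \is a GRing.unit) ->
  W' N (rho K) m = scaleV (\prod_(1 <= j < N.+1) (j%:R * (rho K - 1)))^-1
    (gmap (fun _ : int => gmap (fun _ => rho))
       << weighted_esym N K (cleared_coef N K) m *g 0 >>).
Proof.
move=> N0 nat_unit unit_j; set delta := \prod_(_ <= j < _) _.
have unit_delta : delta \is a GRing.unit.
  by rewrite /delta big_nat unitr_prod // => j /andP[j0 _]; apply: unit_j.
pose phi (f : Fock N S) : Fock N S' := gmap (fun _ => rho) f.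
have phiE f mu : (phi f)@_mu = rho f@_mu by rewrite gmapE // rmorph0.
have phi0 : phi 0 = 0 by exact: coef_map0 phiE.
apply/malgP => n; rewrite scaleVE W'_mcoeff gmapE; last exact: phi0.
rewrite mcoeffU eq_sym; case: eqP => [_|_]; last first.
  by rewrite mulr0n -[gmap _ 0]/(phi 0) phi0 scaler0.
rewrite mulr1n -[gmap _ _]/(phi _) (coef_map_power_sym phiE nat_unit N0).
rewrite /weighted_esym scaler_sumr; apply: eq_bigr => k _; rewrite scalerA.
have E : delta^-1 * rho (cleared_coef N K k) = W'_coef (rho K) k.
  rewrite (cleared_coefE unit_j (leq_ord k)) -/delta.
  by rewrite mulrA (mulVr unit_delta) mul1r.
by rewrite -E.
Qed.

Theorem proposition3p5 (R : realType) (N : nat) (hN : (2 <= N)%N)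
    (m : nat) (hm : (1 <= m <= N)%N) :
  W_loc (W' N (K_loc R) m).
Proof.
have C0 : [pchar R[i]] =i pred0 by exact: Num.Theory.pchar_num.
have poly_unit n : (0 < n)%N -> (n%:R : CK R) \is a GRing.unit.
  move=> n0; rewrite -(rmorph_nat (@polyC R[i])); apply: rmorph_unit.
  by rewrite unitfE (pcharf0P R[i]).1 // -lt0n.
pose rho : {rmorphism CK R -> CKloc R} :=
  GRing.RMorphism.clone _ _ (@loc_of_poly R[i]) _.
have unit_j j : (0 < j)%N -> (j%:R * (rho 'X - 1)) \is a GRing.unit.
  move=> j0; rewrite unitrM loc_nat_unit //.
  have -> : rho 'X - 1 = loc_of_poly ('X - 1) by rewrite rmorphB rmorph1.
  exact: loc_K1_unit.
exists 1%N, (fun=> (\prod_(1 <= j < N.+1) (j%:R * (rho 'X - 1)))^-1).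
exists (fun=> << weighted_esym N 'X (cleared_coef N 'X) m *g 0 >>); split=> [_|].
  exact: (cleared_inW 'X hN poly_unit m).
by rewrite big_ord1; exact: (W'_base_change m (ltnW hN) poly_unit unit_j).
Qed.
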